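(* For a skew partition $\nu/\lambda$, $$g_{\nu/\lambda}(x)=\sum_{T} s_{\mathrm{weight}(T)}(x),$$ where the sum is over all Yamanouchi tabloids $T$ of inflated shape $\nu/\lambda$.
   Context: Rows of shapes are counted upward from the bottom, columns from left to right; $\nu/\lambda$ ($\lambda\subseteq\nu$ partitions) is the set of cells of $\nu$ not in $\lambda$. $s_\mu$ is the Schur function. A reverse plane partition of shape $\nu/\lambda$ is a filling of $\nu/\lambda$ with positive integers that is weakly increasing along rows from left to right and weakly increasing up columns. The weight of a reverse plane partition $r$ is the vector $\alpha$ with $\alpha_i$ the number of columns of $r$ containing $i$. $g_{\nu/\lambda}(x)=\sum_r x^{\mathrm{weight}(r)}$ over all reverse plane partitions $r$ of shape $\nu/\lambda$. A tabloid is a filling of the shape of a composition (zero parts allowed) with positive integers, weakly increasing from left to right along rows; its weight is the composition whose $i$-th entry is the number of $i$'s, and its reading word lists the rows from top to bottom, each from left to right. A tabloid is Yamanouchi if each suffix $b_j\cdots b_1$ of its reading word $b_n\cdots b_1$ has partition weight (i.e. contains at least as many $i$'s as $(i+1)$'s for every $i\ge1$). To a reverse plane partition $r$ of shape $\nu/\lambda$ associate the tabloid obtained by deleting every letter that is not the topmost occurrence of that letter in its column, and then left-justifying the letters of each row (keeping $\ell(\nu)$ rows, some possibly empty). A tabloid has inflated shape $\nu/\lambda$ if it is the tabloid associated in this way to a reverse plane partition of shape $\nu/\lambda$ (which is then unique). *)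

(* Defs.v *)
From mathcomp Require Import all_boot all_order all_algebra finmap.
From mathcomp Require Import boolp classical_sets functions cardinality fsbigop.

Set Implicit Arguments.
Unset Strict Implicit.
Unset Printing Implicit Defensive.

Import GRing.Theory.

(* Formal power series over the integers in countably many commuting variables
   x_1, x_2, ..., as coefficient functions. Exponents are shifted by one:
   [m i] is the exponent of x_(i+1). *)
Definition exponent := {fsfun nat -> nat with 0}.
Definition series := exponent -> int.

(* The weight [a] is a plain function; the weights used below are finitely
   supported, so exactly one exponent [m] agrees with [a]. *)
Definition monomial (a : nat -> nat) : series :=
  fun m => if `[< forall i, m i = a i >] then 1%R else 0%R.

(* The sum of a possibly infinite family of series, taken coefficientwise.
   [\sum_(t \in A)] returns 0 when infinitely many terms are nonzero; this does
   not occur for the families below, in which every monomial appears in only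
   finitely many members. *)
Definition formal_sum (T : choiceType) (A : set T) (f : T -> series) : series :=
  fun m => (\sum_(t \in A) f t m)%R.

Definition is_partition (s : seq nat) : bool := sorted geq s && (0 \notin s).

Definition part_incl (la nu : seq nat) : Prop :=
  forall i, nth 0 la i <= nth 0 nu i.

(* The cell (i, j) lies in row i, counted from the bottom, and in column j,
   counted from the left, both starting at 0. *)
Definition cell := (nat * nat)%type.

Definition in_skew (nu la : seq nat) (c : cell) : bool :=
  nth 0 la c.1 <= c.2 < nth 0 nu c.1.

(* A filling of a finite set of cells with positive integers, extended by 0
   outside that set. *)
Definition filling := {fsfun cell -> nat with 0}.

Definition is_filling (nu la : seq nat) (r : filling) : Prop :=
  forall c, (0 < r c) = in_skew nu la c.

Definition rows_weak (nu la : seq nat) (r : filling) : Prop :=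
  forall i j j', j <= j' -> in_skew nu la (i, j) -> in_skew nu la (i, j') ->
    r (i, j) <= r (i, j').

Definition cols_weak (nu la : seq nat) (r : filling) : Prop :=
  forall i i' j, i <= i' -> in_skew nu la (i, j) -> in_skew nu la (i', j) ->
    r (i, j) <= r (i', j).

Definition cols_strict (nu la : seq nat) (r : filling) : Prop :=
  forall i i' j, i < i' -> in_skew nu la (i, j) -> in_skew nu la (i', j) ->
    r (i, j) < r (i', j).

Definition reverse_plane_partition (nu la : seq nat) (r : filling) : Prop :=
  [/\ is_filling nu la r, rows_weak nu la r & cols_weak nu la r].

(* Number of columns containing the letter i+1. *)
Definition rpp_weight (r : filling) (i : nat) : nat :=
  #|` [fset c.2 | c in finsupp r & r c == i.+1]%fset |.

Definition dual_grothendieck (nu la : seq nat) : series :=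
  formal_sum [set r | reverse_plane_partition nu la r]%classic
    (fun r => monomial (rpp_weight r)).

Definition semistandard (mu : seq nat) (r : filling) : Prop :=
  [/\ is_filling mu [::] r, rows_weak mu [::] r & cols_strict mu [::] r].

(* Number of cells containing the letter i+1. *)
Definition ssyt_weight (r : filling) (i : nat) : nat :=
  #|` [fset c in finsupp r | r c == i.+1]%fset |.

Definition schur (mu : seq nat) : series :=
  formal_sum [set r | semistandard mu r]%classic
    (fun r => monomial (ssyt_weight r)).

(* The list of the rows of a filling of a composition shape, from bottom to
   top; empty rows correspond to zero parts. *)
Definition tabloid (T : seq (seq nat)) : bool :=
  all (fun row => sorted leq row && (0 \notin row)) T.

Definition reading_word (T : seq (seq nat)) : seq nat := flatten (rev T).

(* The composition stops at the largest letter of T, so it has no trailing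
   zeros. *)
Definition tabloid_weight (T : seq (seq nat)) : seq nat :=
  mkseq (fun i => count_mem i.+1 (flatten T)) (\max_(b <- flatten T) b).

Definition yamanouchi (T : seq (seq nat)) : Prop :=
  forall k i, 0 < i ->
    count_mem i.+1 (drop k (reading_word T)) <=
    count_mem i (drop k (reading_word T)).

Definition topmost (nu : seq nat) (r : filling) (i j : nat) : bool :=
  [forall i' : 'I_(size nu), (i < i') ==> (r (val i', j) != r (i, j))].

Definition associated_tabloid (nu la : seq nat) (r : filling) :
    seq (seq nat) :=
  [seq [seq r (i, j) | j <- iota 0 (nth 0 nu i)
                     & in_skew nu la (i, j) && topmost nu r i j]
  | i <- iota 0 (size nu)].

Definition inflated_shape (nu la : seq nat) (T : seq (seq nat)) : Prop :=
  exists2 r, reverse_plane_partition nu la r & T = associated_tabloid nu la r.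

(* Main.v *)
Require Import Defs.
From mathcomp Require Import all_boot all_order all_algebra finmap.
From mathcomp Require Import boolp classical_sets functions cardinality fsbigop.
From mathcomp Require Import fingroup perm ring zify mpoly.

(* Columns are processed from right to left, and a column is recorded by its
   heights: the p-th height is the number of its cells with entry at most p. A
   filling with letters at most N is then a sequence of chains of N+1 heights,
   each chain lying weakly above the chain of the column to its right. Weighting
   each gap d > 0 of a chain by q^(d-1) treats two cases at once: q = 1 gives
   reverse plane partitions and q = 0 gives semistandard tableaux.

   The proof follows Stembridge's proof of the Littlewood-Richardson rule. The
   sum of all the fillings to the left of a column without the letter k is
   symmetric in x_k and x_(k+1) (column_sum_sym). Multiply by x^rho,
   antisymmetrize, and expand one column at a time: as soon as the weight of the
   columns read so far fails to be a partition, the remaining sum is killed.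
   Only Yamanouchi fillings survive (column_sum_alt), each contributing the
   alternant of its weight. For a straight shape and q = 0 a single filling
   survives, so s_mu times the Vandermonde alternant is the alternant of mu, and
   the alternant can be cancelled.

   Reading by columns and reading the tabloid by rows define the same
   Yamanouchi fillings (letters_after_from). *)

Set Implicit Arguments.
Unset Strict Implicit.
Unset Printing Implicit Defensive.
Import GRing.Theory.

Local Open Scope ring_scope.

(** * Sums over the height between two letters *)

Section MiddleHeight.
Variables (A : comNzRingType) (sg : {rmorphism A -> A}) (x y q : A).
Hypotheses (sgx : sg x = y) (sgy : sg y = x) (sgq : sg q = q).

Definition gap (z : A) (d : nat) : A := if d is d'.+1 then q ^+ d' * z else 1.

(* The invariant carried from column to column. Here a and b are the heights of
   a column at the letters k-1 and k+1, and f h is the sum of the fillings to its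
   left when its height at the letter k is h; x, y are the variables of the
   letters k and k+1, exchanged by sg. Only the symmetry at h = a is needed in
   the end; the other two conditions make the induction work. *)
Definition middle_sym (a b : nat) (f : nat -> A) : Prop :=
  [/\ forall h, (h <= a)%N -> sg (f h) = f h,
      (a < b)%N -> sg (x * (f a.+1 - f a)) = x * (f a.+1 - f a) &
      forall h, (a < h < b)%N ->
        sg (x * (q * (f h.+1 - f h) + y * f h)) =
        x * (q * (f h.+1 - f h) + y * f h)].

Variables (t s : nat) (f : nat -> A).
Hypothesis (le_ts : (t <= s)%N).
Hypothesis (f_sym : middle_sym t s f).

Let f0 : sg (f t) = f t. Proof. by case: f_sym => ->. Qed.

Let f1 : (t < s)%N -> sg (x * (f t.+1 - f t)) = x * (f t.+1 - f t).
Proof. by case: f_sym. Qed.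

Let f2 h : (t < h < s)%N ->
  sg (x * (q * (f h.+1 - f h) + y * f h)) = x * (q * (f h.+1 - f h) + y * f h).
Proof. by case: f_sym => _ _; apply. Qed.

(** Here [g] runs over the middle heights of the next column to the left, whose neighbouring heights
    are [t] and [s]; [g >= h] because that column lies above the current one. *)
Definition middle_sum (h : nat) : A :=
  \sum_(maxn t h <= g < s.+1) gap x (g - t) * gap y (s - g) * f g.

Let G h := \sum_(h <= g < s) x * y * f g.

Let middle_sum_const h : (h <= t)%N -> middle_sum h = middle_sum t.
Proof. by move=> le_ht; rewrite /middle_sum maxnn (maxn_idPl le_ht). Qed.

(* The conditions of middle_sym add up over the interval from h to s. *)
Let telescope h : (t <= h <= s)%N ->
  sg (q * x * (f s - f h) + G h) = q * x * (f s - f h) + G h.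
Proof.
move=> /andP[le_th le_hs]; rewrite -(subKn le_hs).
have : (s - h <= s - t)%N by lia.
elim: (s - h)%N => [|d IHd] lt_d.
  by rewrite subn0 subrr mulr0 add0r /G big_geq // rmorph0.
have {IHd} := IHd (ltnW lt_d); have -> : (s - d = (s - d.+1).+1)%N by lia.
have : (t <= s - d.+1 < s)%N by lia.
move: (s - d.+1)%N => g /andP[le_tg lt_gs] IH.
have EG : G g = x * y * f g + G g.+1 by rewrite /G big_ltn.
have step : sg (x * (q * (f g.+1 - f g) + y * f g)) =
    x * (q * (f g.+1 - f g) + y * f g).
  have := le_tg; rewrite leq_eqVlt => /predU1P[<- |lt_tg]; last first.
    by apply: f2; rewrite lt_tg.
  have -> : x * (q * (f t.+1 - f t) + y * f t) =
    q * (x * (f t.+1 - f t)) + x * y * f t by ring.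
  rewrite rmorphD [sg (q * _)]rmorphM f1 ?(leq_ltn_trans le_tg lt_gs) //.
  by rewrite !rmorphM sgx sgy sgq f0; ring.
have -> : q * x * (f s - f g) + G g =
  (q * x * (f s - f g.+1) + G g.+1) + x * (q * (f g.+1 - f g) + y * f g).
  by rewrite EG; ring.
by rewrite rmorphD step IH.
Qed.

(** For [t < g < s] the two gaps multiply to [q ^+ (s - t.+2) * x * y] whatever [g] is. Only the end
    [g = s] differs, with one more [q] and no [y]. *)
Let middle_sum_above h : (t.+2 <= s)%N -> (t < h <= s)%N ->
  middle_sum h = q ^+ (s - t.+2) * (G h + q * x * f s).
Proof.
move=> lt_ts /andP[lt_th le_hs]; rewrite /middle_sum (maxn_idPr (ltnW lt_th)).
rewrite big_nat_recr //= subnn mulrDr; congr (_ + _); last first.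
  have -> : (s - t = (s - t.+2).+2)%N by lia.
  by rewrite /= exprS; ring.
rewrite /G big_distrr /=; apply: eq_big_nat => g /andP[le_hg lt_gs].
have -> : (g - t = (g - t.+1).+1)%N by lia.
have -> : (s - g = (s - g.+1).+1)%N by lia.
have -> : (s - t.+2 = (g - t.+1) + (s - g.+1))%N by lia.
by rewrite /= exprD; ring.
Qed.

Let middle_sum_step h : (t <= h < s)%N ->
  middle_sum h = gap x (h - t) * gap y (s - h) * f h + middle_sum h.+1.
Proof.
move=> /andP[le_th lt_hs]; rewrite /middle_sum (maxn_idPr le_th).
by rewrite (maxn_idPr (leqW le_th)) big_ltn // ltnW.
Qed.

Let middle_sum_sym : sg (middle_sum t) = middle_sum t.
Proof.
move: le_ts; rewrite leq_eqVlt => /predU1P[Ets | lt_ts].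
  by rewrite /middle_sum maxnn -Ets big_nat1 subnn /= !mul1r f0.
move: (lt_ts); rewrite leq_eqVlt => /predU1P[Ets | lt_t1s].
  rewrite /middle_sum maxnn -Ets big_nat_recr //= big_nat1 !subnn subSnn.
  rewrite /= expr0 !mul1r mulr1.
  have -> : y * f t + x * f t.+1 = x * (f t.+1 - f t) + (x + y) * f t by ring.
  by rewrite rmorphD f1 // rmorphM f0 rmorphD sgx sgy; ring.
rewrite (@middle_sum_step t) ?leqnn //.
rewrite middle_sum_above ?lt_t1s ?leqnn //= subnn.
have -> : (s - t = (s - t.+2).+2)%N by lia.
(* The regrouping isolates the combination of [telescope]; what is left is [f t] times a symmetric
   polynomial in [x] and [y]. *)
have -> : gap x 0 * gap y (s - t.+2).+2 * f t +
    q ^+ (s - t.+2) * (G t.+1 + q * x * f s) =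
  q ^+ (s - t.+2) * ((q * x * (f s - f t) + G t) + (q * (x + y) - x * y) * f t).
  by rewrite /= [G t]big_ltn // -/(G t.+1) exprS; ring.
rewrite rmorphM rmorphXn sgq rmorphD telescope ?leqnn //.
by rewrite rmorphM rmorphB f0 !rmorphM rmorphD sgx sgy sgq; ring.
Qed.

Let sym_xy h : sg (f h) = f h -> sg (x * y * f h) = x * y * f h.
Proof. by move=> fh; rewrite !rmorphM sgx sgy fh; ring. Qed.

Let middle_sum_sym1 : (t < s)%N ->
  sg (x * (middle_sum t.+1 - middle_sum t)) =
  x * (middle_sum t.+1 - middle_sum t).
Proof.
move=> lt_ts; rewrite (@middle_sum_step t) ?leqnn //.
have -> : (s - t = (s - t.+1).+1)%N by lia.
rewrite subnn /=.
have -> : x * (middle_sum t.+1 -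
    (1 * (q ^+ (s - t.+1) * y) * f t + middle_sum t.+1)) =
  - (q ^+ (s - t.+1) * (x * y * f t)) by ring.
by rewrite rmorphN rmorphM rmorphXn sgq sym_xy.
Qed.

Let middle_sum_sym2 h : (h < s)%N ->
  sg (x * (q * (middle_sum h.+1 - middle_sum h) + y * middle_sum h)) =
  x * (q * (middle_sum h.+1 - middle_sum h) + y * middle_sum h).
Proof.
move=> lt_hs; case: (ltngtP h t) => [lt_ht | lt_th | Eht].
- rewrite !middle_sum_const //; last exact: ltnW.
  rewrite subrr mulr0 add0r !rmorphM sgx sgy middle_sum_sym; ring.
- have lt_t1s : (t.+2 <= s)%N by apply: leq_ltn_trans lt_hs.
  have h_in : (t < h <= s)%N by lia.
  have h1_in : (t < h.+1 <= s)%N by lia.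
  rewrite !middle_sum_above //.
  have -> : x * (q * (q ^+ (s - t.+2) * (G h.+1 + q * x * f s) -
      q ^+ (s - t.+2) * (G h + q * x * f s)) +
      y * (q ^+ (s - t.+2) * (G h + q * x * f s))) =
    q ^+ (s - t.+2) * (x * y) * (q * x * (f s - f h) + G h).
    by rewrite [G h]big_ltn // -/(G h.+1); ring.
  rewrite rmorphM telescope ?(ltnW lt_th) ?(ltnW lt_hs) //.
  by rewrite !rmorphM rmorphXn sgx sgy sgq; ring.
- move: lt_hs; rewrite Eht => lt_ts.
  have -> : x * (q * (middle_sum t.+1 - middle_sum t) + y * middle_sum t) =
    q * (x * (middle_sum t.+1 - middle_sum t)) + x * y * middle_sum t by ring.
  rewrite rmorphD [sg (q * _)]rmorphM sgq middle_sum_sym1 //.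
  by rewrite !rmorphM sgx sgy middle_sum_sym; ring.
Qed.

(** The invariant passes from a column to its right neighbour, whose heights are [a] and [b]; the
    inequalities say that the left column lies above it. *)
Lemma middle_sym_middle_sum a b : (a <= t)%N -> (b <= s)%N ->
  middle_sym a b middle_sum.
Proof.
move=> le_at le_bs; split=> [h le_ha | lt_ab | h /andP[_ lt_hb]].
- by rewrite middle_sum_const ?middle_sum_sym // (leq_trans le_ha).
- move: le_at; rewrite leq_eqVlt => /predU1P[Eat | lt_at].
    by rewrite Eat; apply: middle_sum_sym1; lia.
  rewrite !(@middle_sum_const _ _) //; last exact: ltnW.
  by rewrite subrr mulr0 rmorph0.
- by apply: middle_sum_sym2; apply: leq_trans le_bs.
Qed.
End MiddleHeight.

(** The conditions are linear in [f], so they survive symmetric coefficients, such as the weights of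
    the letters that are not exchanged. *)
Lemma middle_sym_sum (A : comNzRingType) (sg : {rmorphism A -> A}) (x y q : A)
    (I : finType) (P : pred I) (w : I -> A) (F : I -> nat -> A) (a b : nat) :
    (forall i, P i -> sg (w i) = w i) ->
    (forall i, P i -> middle_sym sg x y q a b (F i)) ->
  middle_sym sg x y q a b (fun h => \sum_(i | P i) w i * F i h).
Proof.
move=> w_sym F_sym; split=> [h le_ha | lt_ab | h h_in].
- rewrite rmorph_sum; apply: eq_bigr => i Pi; case: (F_sym i Pi) => F0 _ _.
  by rewrite rmorphM w_sym // F0.
- rewrite -sumrB mulr_sumr rmorph_sum; apply: eq_bigr => i Pi.
  case: (F_sym i Pi) => _ F1 _.
  by rewrite -mulrBr mulrCA rmorphM w_sym // F1.
rewrite -sumrB !mulr_sumr -big_split mulr_sumr rmorph_sum.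
apply: eq_bigr => i Pi; case: (F_sym i Pi) => _ _ F2 /=.
have -> : x * (q * (w i * F i h.+1 - w i * F i h) + y * (w i * F i h)) =
  w i * (x * (q * (F i h.+1 - F i h) + y * F i h)) by ring.
by rewrite rmorphM w_sym // F2.
Qed.

Lemma eq_middle_sym (A : comNzRingType) (sg : {rmorphism A -> A}) (x y q : A)
    (a b m : nat) (f f' : nat -> A) :
    (a <= m)%N -> (b <= m)%N -> (forall h, (h <= m)%N -> f h = f' h) ->
  middle_sym sg x y q a b f' -> middle_sym sg x y q a b f.
Proof.
move=> le_am le_bm Ef [f0 f1 f2]; split=> [h le_ha | lt_ab | h /andP[lt_ah lt_hb]].
- by rewrite Ef ?f0 // (leq_trans le_ha).
- by rewrite !Ef ?f1 // (leq_trans lt_ab).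
- have lt_hm := leq_trans lt_hb le_bm.
  by rewrite !Ef ?f2 ?lt_ah // ltnW.
Qed.

(** * Columns as chains of heights *)

Section Chains.
Variables N B : nat.

(** The bound [B] on the heights makes the chains a finite type, so that columns can be summed
    over. *)
Definition chain := {ffun 'I_N.+1 -> 'I_B.+1}.
Implicit Types c e : chain.

Definition ht c (p : nat) : nat := c (inord p).

Definition is_chain (t s : nat) c : bool :=
  [&& ht c 0 == t, ht c N == s & [forall p : 'I_N, (ht c p <= ht c p.+1)%N]].

Definition above c c' : bool := [forall p : 'I_N.+1, (ht c p <= ht c' p)%N].

Definition colwt c : 'X_{1..N} :=
  [multinom nat_of_bool (ht c p < ht c p.+1)%N | p < N].

(** The number of repeated entries of a column, which is the exponent of [q]. *)
Definition excess c : nat := (\sum_(p < N) (ht c p.+1 - ht c p).-1)%N.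

Variable q : int.

Definition colw c : {mpoly int[N]} := q ^+ excess c *: 'X_[colwt c].

Lemma colw_gap c :
  colw c = \prod_(p < N) gap q%:MP 'X_p (ht c p.+1 - ht c p)%N.
Proof.
rewrite /colw /excess mpolyXE_id expr_sum -mul_mpolyC rmorph_prod -big_split /=.
apply: eq_bigr => p _; rewrite mnmE rmorphXn.
by rewrite -subn_gt0; case: (_ - _)%N => [|d] /=; rewrite ?expr0 ?mulr1 ?expr1.
Qed.

(** The generating function of the columns to the left of [c], listed from right to left by their
    bottom and top heights. *)
Fixpoint column_sum (cs : seq (nat * nat)) c : {mpoly int[N]} :=
  if cs is (t, s) :: cs' then
    \sum_(c' | is_chain t s c' && above c c') colw c' * column_sum cs' c'
  else 1.

(** * Symmetry under the exchange of two adjacent letters *)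

Section AdjacentLetters.
Variables (k : nat) (lt_k1N : (k.+1 < N)%N).

Let k0 : 'I_N := Ordinal (ltnW lt_k1N).
Let k1 : 'I_N := Ordinal lt_k1N.
Let sg : {rmorphism {mpoly int[N]} -> {mpoly int[N]}} := msym (tperm k0 k1).

Definition upd c (h : nat) : chain :=
  [ffun p : 'I_N.+1 => if val p == k.+1 then inord h else c p].

Lemma ht_upd c h p : (p <= N)%N -> (h <= B)%N ->
  ht (upd c h) p = if p == k.+1 then h else ht c p.
Proof.
by move=> le_pN le_hB; rewrite /ht ffunE /= inordK //; case: eqP; rewrite ?inordK.
Qed.

Lemma ht_le c p : (ht c p <= B)%N. Proof. by rewrite -ltnS ltn_ord. Qed.

Lemma upd_id c : upd c (ht c k.+1) = c.
Proof.
apply/ffunP => p; rewrite ffunE; case: eqP => // Ep.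
by rewrite -Ep /ht inord_val inord_val.
Qed.

Lemma upd_upd c h h' : upd (upd c h) h' = upd c h'.
Proof. by apply/ffunP => p; rewrite !ffunE; case: eqP. Qed.

(** A chain amounts to its height at [k.+1] and the rest; [e], normalized to height 0 there,
    represents the rest. *)
Lemma sum_by_middle_height (P : pred chain) (F : chain -> {mpoly int[N]}) :
  \sum_(c | P c) F c =
  \sum_(e | ht e k.+1 == 0%N) \sum_(g < B.+1 | P (upd e g)) F (upd e g).
Proof.
have le_k1N := ltnW lt_k1N.
rewrite (partition_big (fun c => upd c 0) (fun e => ht e k.+1 == 0%N)) /=; last first.
  by move=> c _; rewrite ht_upd ?eqxx.
apply: eq_bigr => e /eqP e0.
rewrite (reindex_onto (fun g : 'I_B.+1 => upd e g) (fun c => c (inord k.+1))) /=.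
  apply: eq_bigl => g; rewrite upd_upd -e0 upd_id eqxx andbT.
  by rewrite ffunE /= inordK // eqxx inord_val eqxx andbT.
by move=> c /andP[_ /eqP<-]; rewrite upd_upd upd_id.
Qed.


Let nk10 : k1 != k0. Proof. by rewrite -val_eqE /= gtn_eqF. Qed.

Let sgX (p : 'I_N) : sg 'X_p = 'X_(tperm k0 k1 p).
Proof. by rewrite /sg /= /msym mmapX mmap1U. Qed.

Let sgC (a : int) : sg a%:MP = a%:MP.
Proof. by rewrite /sg /= /msym mmapC. Qed.

Let ok (t s : nat) c e : bool :=
  [&& ht e 0 == t, ht e N == s, (ht e k <= ht e k.+2)%N,
      [forall p : 'I_N, (p != k0) && (p != k1) ==> (ht e p <= ht e p.+1)%N] &
      [forall p : 'I_N.+1, (val p != k.+1) ==> (ht c p <= ht e p)%N]].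

Let other e : {mpoly int[N]} :=
  \prod_(p < N | (p != k0) && (p != k1)) gap q%:MP 'X_p (ht e p.+1 - ht e p)%N.

Let other_sym e : sg (other e) = other e.
Proof.
rewrite rmorph_prod; apply: eq_bigr => p /andP[nk0 nk1].
case: (_ - _)%N => [|d] /=; first by rewrite rmorph1.
rewrite rmorphM rmorphXn sgC sgX tpermD // eq_sym //.
Qed.

Let colw_upd e g : (g <= B)%N -> colw (upd e g) =
  other e * (gap q%:MP 'X_k0 (g - ht e k)%N * gap q%:MP 'X_k1 (ht e k.+2 - g)%N).
Proof.
move=> le_gB; rewrite colw_gap (bigD1 k0) //= (bigD1 k1) //= mulrA mulrC.
congr (_ * (_ * _)).
- apply: eq_bigr => p /andP[nk0 nk1].
  rewrite !ht_upd // 1?ltnW // eqSS -!val_eqE /= in nk0 nk1 *.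
  by rewrite (negPf nk0) (negPf nk1).
- by rewrite !ht_upd // ?eqxx ?ltn_eqF //; lia.
- by rewrite !ht_upd // ?eqxx ?gtn_eqF //; lia.
Qed.

Let fits_upd t s c e h g : (h <= B)%N -> (g <= B)%N ->
  is_chain t s (upd e g) && above (upd c h) (upd e g) =
  ok t s c e && ((ht e k <= g <= ht e k.+2) && (h <= g))%N.
Proof.
move=> le_hB le_gB; rewrite /is_chain /ok !ht_upd //= (gtn_eqF lt_k1N).
rewrite -!andbA; do 2! congr (_ && _).
have le_kN : (k <= N)%N by lia.
have [ek ek2] : k == k.+1 = false /\ k.+2 == k.+1 = false by split; lia.
apply/andP/and5P.
  move=> [/forallP mono /forallP abv].
  have lo : (ht e k <= g)%N.
    by have := mono k0; rewrite !ht_upd //= ?eqxx ?ek // ltnW.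
  have hi : (g <= ht e k.+2)%N.
    by have := mono k1; rewrite !ht_upd //= ?eqxx ?ek2 // ltnW.
  split=> //; first exact: leq_trans hi.
  - apply/forallP => p; apply/implyP => /andP[nk0 nk1]; have := mono p.
    rewrite -!val_eqE /= in nk0 nk1; rewrite !ht_upd ?eqSS //; last exact: ltnW.
    by rewrite (negPf nk0) (negPf nk1).
  - apply/forallP => p; apply/implyP => nk1; have := abv p.
    have le_pN : (p <= N)%N by rewrite -ltnS.
    by rewrite !ht_upd // (negPf nk1).
  - rewrite hi; have := abv (inord k.+1).
    by rewrite !ht_upd ?inordK ?eqxx // ltnW.
move=> [le_e /forallP mono /forallP abv lo /andP[hi le_hg]]; split.
  apply/forallP => p; rewrite !ht_upd ?eqSS //; last exact: ltnW.
  have := mono p; rewrite -!val_eqE /=.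
  case: (eqVneq (val p) k) => [-> | _]; first by rewrite ek.
  by case: (eqVneq (val p) k.+1) => [-> |].
apply/forallP => p; have le_pN : (p <= N)%N by rewrite -ltnS.
rewrite !ht_upd //; have := abv p.
by case: (val p == k.+1).
Qed.

Let sum_as_middle_sum t s h (f : nat -> {mpoly int[N]}) : (s <= B)%N ->
  \sum_(g < B.+1 | (t <= g <= s)%N && (h <= g)%N)
    gap q%:MP 'X_k0 (g - t)%N * gap q%:MP 'X_k1 (s - g)%N * f g =
  middle_sum 'X_k0 'X_k1 q%:MP t s f h.
Proof.
move=> le_sB; rewrite /middle_sum.
rewrite (big_nat_widenl _ 0) // (big_nat_widen _ _ B.+1) // big_mkord.
by apply: eq_bigl => g; lia.
Qed.

(** Induction on the columns. With all but the middle height fixed, the sum over the next column is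
    a [middle_sum], and the other factors do not involve the two exchanged variables. *)
Lemma column_sum_middle_sym cs c :
  middle_sym sg 'X_k0 'X_k1 q%:MP (ht c k) (ht c k.+2)
    (fun h => column_sum cs (upd c h)).
Proof.
have sgX0 : sg 'X_k0 = 'X_k1 by rewrite sgX tpermL.
have sgX1 : sg 'X_k1 = 'X_k0 by rewrite sgX tpermR.
have le_k1N := ltnW lt_k1N; have le_kN := ltnW le_k1N.
elim: cs c => [|[t s] cs IH] c /=.
  split=> [h _ | _ | h _]; first by rewrite rmorph1.
    by rewrite subrr mulr0 rmorph0.
  by rewrite subrr mulr0 add0r mulr1 rmorphM sgX0 sgX1 mulrC.
pose F e g := column_sum cs (upd e g).
pose M e := middle_sum 'X_k0 'X_k1 q%:MP (ht e k) (ht e k.+2) (F e).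
apply: (@eq_middle_sym _ _ _ _ _ _ _ B _ (fun h =>
    \sum_(e | (ht e k.+1 == 0%N) && ok t s c e) other e * M e h)); rewrite ?ht_le //.
  move=> h le_hB; rewrite sum_by_middle_height [RHS]big_mkcondr /=.
  apply: eq_bigr => e _; case: ifP => [e_ok | e_nok]; last first.
    by apply: big_pred0 => g; rewrite fits_upd ?e_nok // -ltnS.
  rewrite /M -sum_as_middle_sum ?ht_le // mulr_sumr.
  apply: eq_big => [g | g _]; first by rewrite fits_upd ?e_ok // -ltnS.
  have le_gB : (g <= B)%N by rewrite -ltnS.
  by rewrite colw_upd ?mulrA.
apply: middle_sym_sum => e => [_ | /andP[_]]; first exact: other_sym.
(* Lying above [c] at the indices [k] and [k.+2] supplies the two inequalities that transfer the
   invariant. *)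
case/and5P=> _ _ le_e _ /forallP abv; apply: middle_sym_middle_sum => //.
- by have := abv (inord k); rewrite /= !inordK // ltn_eqF.
- by have := abv (inord k.+2); rewrite /= !inordK // gtn_eqF.
Qed.

Lemma column_sum_sym cs c : (ht c k.+1 <= ht c k)%N ->
  msym (tperm k0 k1) (column_sum cs c) = column_sum cs c.
Proof.
move=> le_c; have [sym0 _ _] := column_sum_middle_sym cs c.
by have := sym0 _ le_c; rewrite upd_id.
Qed.

End AdjacentLetters.
End Chains.

(** * Alternants *)

Section Alternant.
Variable N : nat.
Implicit Types (p : {mpoly int[N]}) (m : 'X_{1..N}).

Definition rho : 'X_{1..N} := [multinom (N - i.+1)%N | i < N].

(** With the factor ['X_[rho]] built in, [alt 'X_[m]] is the determinant with exponents [m + rho],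
    and [alt 1] is the Vandermonde determinant. *)
Definition alt p : {mpoly int[N]} :=
  \sum_(w : 'S_N) (-1) ^+ w *: msym w ('X_[rho] * p).

Lemma alt_sum (I : Type) (r : seq I) (P : pred I) (F : I -> {mpoly int[N]}) :
  alt (\sum_(i <- r | P i) F i) = \sum_(i <- r | P i) alt (F i).
Proof.
rewrite /alt [RHS]exchange_big; apply: eq_bigr => w _ /=.
by rewrite mulr_sumr (raddf_sum (msym w)) scaler_sumr.
Qed.

Lemma altZ a p : alt (a *: p) = a *: alt p.
Proof.
rewrite /alt scaler_sumr; apply: eq_bigr => w _.
by rewrite -scalerAr msymZ !scalerA mulrC.
Qed.

(** Composing with the transposition permutes the terms and flips every sign, so [alt p = - alt p],
    and there is no 2-torsion. *)
Lemma alt_eq0 (k l : 'I_N) p : k != l ->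
  msym (tperm k l) ('X_[rho] * p) = 'X_[rho] * p -> alt p = 0.
Proof.
move=> neq_kl sym_p; suff : alt p = - alt p.
  move/eqP; rewrite -addr_eq0 -mulr2n -mulr_natl mulf_eq0.
  by rewrite -mpolyC_nat mpolyC_eq0 => /eqP.
rewrite {1}/alt (reindex_inj (mulgI (tperm k l))) -sumrN; apply: eq_bigr => w _.
by rewrite msymMm sym_p odd_mul_tperm neq_kl signr_addb mulN1r scaleNr.
Qed.

Lemma alt_mul_sym p z : (forall w, msym w z = z) -> alt (p * z) = alt p * z.
Proof.
move=> sym_z; rewrite /alt mulr_suml; apply: eq_bigr => w _.
by rewrite mulrA msymM sym_z scalerAl.
Qed.

(** Conjugation by an adjacent transposition shortens a transposition of distant letters, and
    transpositions generate the group. *)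
Lemma msym_adjacent p :
    (forall k l : 'I_N, l = k.+1 :> nat -> msym (tperm k l) p = p) ->
  forall w, msym w p = p.
Proof.
move=> adj.
have lt_sym n (i j : 'I_N) : j = n :> nat -> (i < j)%N -> msym (tperm i j) p = p.
  elim: n j => [|n IHn] j Ej lt_ij; first by rewrite Ej in lt_ij.
  have [Eij | neq_ij] := eqVneq (i : nat) n; first by apply: adj; rewrite Ej Eij.
  have lt_in : (i < n)%N by rewrite ltn_neqAle neq_ij -ltnS -Ej.
  have lt_nN : (n < N)%N by rewrite ltnW // -Ej.
  pose l := Ordinal lt_nN.
  have -> : tperm i j = (tperm l j * tperm i l * tperm l j)%g.
    rewrite -mulgA -{1}(tpermV l j) -conjgE tpermJ tpermL tpermD //.
      by rewrite eq_sym -val_eqE.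
    by rewrite eq_sym -val_eqE /= ltn_eqF.
  by rewrite !msymMm adj ?IHn // adj.
move=> w; have [ts -> _] := prod_tpermP w.
elim: ts => [|[i j] ts IHts]; first by rewrite big_nil msym1m.
rewrite big_cons msymMm /=; have [lt_ij | lt_ji | Eij] := ltngtP i j.
- by rewrite (lt_sym _ _ _ erefl lt_ij).
- by rewrite tpermC (lt_sym _ _ _ erefl lt_ji).
- by rewrite (val_inj Eij) tperm1 msym1m.
Qed.

(** The coefficient at [rho] is 1: its parts are distinct, so only the identity fixes it. *)
Lemma alt1_neq0 : alt 1 != 0.
Proof.
apply/eqP => /(congr1 (fun p => p@_rho)); rewrite mcoeff0 /alt raddf_sum /=.
rewrite (bigD1 1%g) //= big1 ?addr0 => [|w neq_w1].
  by rewrite odd_perm1 mulr1 msym1m mcoeffZ mcoeffX eqxx.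
rewrite mulr1 mcoeffZ msymX mcoeffX; case: eqP => [/mnmP Ew | _]; last by rewrite mulr0.
case/eqP: neq_w1; apply/permP => i; rewrite perm1.
have := Ew (w i); rewrite !mnmE permK => Ei; apply/val_inj; move: Ei => /=.
have := ltn_ord i; have := ltn_ord (w i); lia.
Qed.

Definition decreasing m : bool :=
  [forall i : 'I_N, [forall j : 'I_N, (val j == i.+1) ==> (m j <= m i)%N]].

End Alternant.

(** * Expansion of alternants over Yamanouchi fillings *)

Section Objects.
Variables (N B : nat) (q : int).
Local Notation chain := (chain N B).
Implicit Types (c : chain) (o : seq chain) (b : 'X_{1..N}).

Fixpoint objs (cs : seq (nat * nat)) c : seq (seq chain) :=
  if cs is (t, s) :: cs' then
    [seq c' :: o | c' <- enum [pred c' | is_chain t s c' && above c c'],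
                   o <- objs cs' c']
  else [:: [::]].

Definition wt o : 'X_{1..N} := (\sum_(c <- o) colwt c)%MM.

Definition total_excess o : nat := (\sum_(c <- o) excess c)%N.

Lemma wt_cons c o : wt (c :: o) = (colwt c + wt o)%MM.
Proof. exact: big_cons. Qed.

Lemma total_excess_cons c o :
  total_excess (c :: o) = (excess c + total_excess o)%N.
Proof. exact: big_cons. Qed.

(** The Yamanouchi condition read by columns, from right to left, after columns of total weight
    [b]. *)
Fixpoint yam b o : bool :=
  if o is c :: o' then decreasing (b + colwt c)%MM && yam (b + colwt c)%MM o'
  else true.

Lemma big_objs_cons t s cs c (F : seq chain -> {mpoly int[N]}) :
  \sum_(o <- objs ((t, s) :: cs) c) F o =
  \sum_(c' | is_chain t s c' && above c c') \sum_(o <- objs cs c') F (c' :: o).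
Proof. by rewrite big_allpairs_dep big_enum. Qed.

Lemma column_sumE cs c :
  column_sum q cs c = \sum_(o <- objs cs c) q ^+ total_excess o *: 'X_[wt o].
Proof.
elim: cs c => [|[t s] cs IH] c.
  by rewrite big_seq1 /wt /total_excess !big_nil expr0 scale1r mpolyX0.
rewrite big_objs_cons /=; apply: eq_bigr => c' _.
rewrite IH mulr_sumr; apply: eq_bigr => o _.
rewrite wt_cons total_excess_cons mpolyXD exprD /colw.
by rewrite -scalerAl -scalerAr scalerA.
Qed.

(** One column [c'] is read at a time. If [b + colwt c'] stays decreasing, induction applies;
    otherwise everything that follows [c'] is killed by [alt_eq0]. *)
Lemma alt_column_sum cs c b : decreasing b ->
  alt ('X_[b] * column_sum q cs c) =
  \sum_(o <- objs cs c | yam b o) q ^+ total_excess o *: alt 'X_[b + wt o].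
Proof.
elim: cs c b => [|[t s] cs IH] c b dec_b.
  by rewrite big_cons /wt /total_excess !big_nil expr0 scale1r mulr1 addm0 addr0.
rewrite big_mkcond big_objs_cons /= mulr_sumr alt_sum; apply: eq_bigr => c' _.
rewrite -scalerAl -scalerAr altZ mulrA -mpolyXD.
case: (boolP (decreasing (b + colwt c')%MM)) => [dec_b' | ndec].
  rewrite IH // scaler_sumr [LHS]big_mkcond; apply: eq_bigr => o _ /=.
  rewrite wt_cons total_excess_cons exprD addmA.
  by rewrite scalerA.
rewrite [RHS]big1 //=.
move: ndec; rewrite negb_forall => /existsP[i].
rewrite negb_forall => /existsP[j]; rewrite negb_imply -ltnNge.
move=> /andP[/eqP Ej lt_ij].
have le_b : (b j <= b i)%N.
  by move/forallP/(_ i)/forallP/(_ j)/implyP: dec_b; apply; apply/eqP.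
have lt_j1N : (i.+1 < N)%N by rewrite -Ej ltn_ord.
(* Column weights are 0 or 1, so the failure forces [b i = b j], with [c'] containing the letter of
   [j] but not that of [i]. *)
move: lt_ij; rewrite !mnmDE !mnmE => lt_ij.
have le_c' : (ht c' i.+1 <= ht c' i)%N.
  rewrite leqNgt; case: (ht c' i < ht c' i.+1)%N lt_ij => //.
  by case: (ht c' j < ht c' j.+1)%N; lia.
have sym_c' := @column_sum_sym N B q i lt_j1N cs c' le_c'.
rewrite (alt_eq0 (k := i) (l := j)) ?scaler0 //.
  by rewrite -val_eqE /= Ej ltn_eqF.
have [Ei1 Ej1] : i = Ordinal (ltnW lt_j1N) /\ j = Ordinal lt_j1N.
  by split; apply: val_inj.
(* As [rho i = rho j + 1], the exponent [rho + b + colwt c'] agrees at [i] and [j]; the remaining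
   sum is symmetric because [c'] lacks the letter of [i]. *)
rewrite !mulrA -mpolyXD msymM [in X in _ * X]Ei1 [in X in _ * X]Ej1 sym_c' msymX.
congr ('X_[_] * _); apply/mnmP => l; rewrite tpermV !mnmE.
move: lt_ij (ltn_ord j) le_b.
have Ej' : j = i.+1 :> nat := Ej.
case: tpermP => [-> | -> | //]; case: (ht c' i < ht c' i.+1)%N;
  case: (ht c' j < ht c' j.+1)%N; lia.
Qed.

(** The hypothesis on [c] makes the full sum symmetric in all variables, so it factors out of its
    alternant. *)
Theorem column_sum_alt cs c :
    (forall k, (k.+1 < N)%N -> (ht c k.+1 <= ht c k)%N) ->
  column_sum q cs c * alt 1 =
  \sum_(o <- objs cs c | yam 0%MM o) q ^+ total_excess o *: alt 'X_[wt o].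
Proof.
move=> flat_c.
have dec0 : decreasing (0%MM : 'X_{1..N}).
  by apply/forallP => i; apply/forallP => j; rewrite !mnmE implybT.
have := alt_column_sum cs c dec0.
under eq_bigr do rewrite add0m.
rewrite mpolyX0 alt_mul_sym 1?mulrC // => w.
apply: msym_adjacent => k l El.
have lt_k1N : (k.+1 < N)%N by rewrite -El ltn_ord.
have := column_sum_sym q lt_k1N cs (flat_c _ lt_k1N).
have -> : Ordinal (ltnW lt_k1N) = k by apply: val_inj.
by have -> : Ordinal lt_k1N = l by apply: val_inj.
Qed.

End Objects.

(** * Straight shapes *)

Section StraightShape.
Variables N B : nat.
Local Notation chain := (chain N B).
Implicit Types (c : chain) (b : 'X_{1..N}).

(** For [s <= N], the column with entries 1, ..., [s] from the bottom. The empty column [canon 0]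
    also serves as a start that constrains nothing. *)
Definition canon (s : nat) : chain := [ffun p : 'I_N.+1 => inord (minn p s)].

Lemma ht_canon s p : (s <= B)%N -> (p <= N)%N -> ht (canon s) p = minn p s.
Proof.
by move=> le_sB le_pN; rewrite /ht ffunE !inordK // ltnS (leq_trans (geq_minr _ _)).
Qed.

Lemma eq_canon s c : (s <= B)%N ->
  (forall p, (p <= N)%N -> ht c p = minn p s) -> c = canon s.
Proof.
move=> le_sB Ec; apply/ffunP => p; apply: val_inj => /=.
have le_pN : (p <= N)%N by rewrite -ltnS ltn_ord.
by have := Ec p le_pN; rewrite -(ht_canon le_sB) // /ht inord_val.
Qed.

Definition letters_upto (s : nat) : 'X_{1..N} :=
  [multinom nat_of_bool (p < s)%N | p < N].

Lemma colwt_canon s : (s <= B)%N -> colwt (canon s) = letters_upto s.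
Proof.
move=> le_sB; apply/mnmP => p; have le_pN := ltnW (ltn_ord p).
rewrite !mnmE !ht_canon //.
by have -> : (minn p s < minn p.+1 s)%N = (p < s)%N by lia.
Qed.

Lemma excess_eq0 c : (excess c == 0%N) =
  [forall p : 'I_N, (ht c p.+1 <= (ht c p).+1)%N].
Proof.
rewrite sum_nat_eq0; apply: eq_forallb => p /=; lia.
Qed.

Lemma excess_canon s : (s <= B)%N -> excess (canon s) = 0%N.
Proof.
move=> le_sB; apply/eqP; rewrite excess_eq0; apply/forallP => p.
by have le_pN := ltnW (ltn_ord p); rewrite !ht_canon //; lia.
Qed.

(** A column that skips a letter and uses the next one needs a drop of [b] there; drops occur only
    up to [s0], where lying above [canon s0] forbids the skip. *)
Lemma canon_unique s0 s b c : (s0 <= B)%N -> (s <= B)%N ->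
    (forall i j : 'I_N, j = i.+1 :> nat -> (b j < b i)%N -> (j <= s0)%N) ->
    is_chain 0 s c -> above (canon s0) c -> excess c = 0%N ->
  decreasing (b + colwt c)%MM -> c = canon s.
Proof.
move=> le_s0B le_sB b_drop /and3P[/eqP c0 /eqP cN /forallP mono] /forallP abv.
move=> /eqP; rewrite excess_eq0 => /forallP gap1 dec_b.
have grow p d : (p + d <= N)%N -> (ht c p <= ht c (p + d) <= ht c p + d)%N.
  elim: d => [|d IHd] le_pd; first by rewrite !addn0 leqnn.
  have lt_pd : (p + d < N)%N by rewrite -addnS.
  have := IHd (ltnW lt_pd); have := mono (Ordinal lt_pd).
  have := gap1 (Ordinal lt_pd); rewrite /= !addnS; lia.
have full p : (p < N)%N -> (ht c p < ht c p.+1)%N -> ht c p = p.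
  elim: p => [|p IHp] lt_pN lt_c; first by rewrite c0.
  have := mono (Ordinal (ltnW lt_pN)); have := gap1 (Ordinal (ltnW lt_pN)).
  have := IHp (ltnW lt_pN); rewrite /=.
  have := grow 0%N p (ltnW (ltnW lt_pN)); rewrite c0 !add0n.
  case: (ltnP (ht c p) (ht c p.+1)) => [lt_p | le_p]; first lia.
  pose i := Ordinal (ltnW lt_pN); pose j := Ordinal lt_pN.
  have := forallP (forallP dec_b i) j; rewrite eqxx /= !mnmDE !mnmE /=.
  rewrite lt_c ltnNge le_p /= => lt_b.
  have le_ps0 : (p.+1 <= s0)%N.
    by apply: (b_drop i j erefl); move: lt_b; rewrite addn0 addn1.
  have := abv (inord p.+1); rewrite inordK; last by rewrite ltnS ltnW.
  by rewrite ht_canon ?(ltnW lt_pN) // (minn_idPl le_ps0); lia.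
apply: eq_canon => // p le_pN.
have := grow 0%N p le_pN; rewrite c0 !add0n.
have := grow p (N - p)%N; rewrite subnKC // cN.
case: (ltnP (ht c p) p) => [lt_cp | le_pc]; last by lia.
suff const d : (p + d <= N)%N -> ht c (p + d) = ht c p.
  by have := const (N - p)%N; rewrite subnKC // cN; lia.
elim: d => [|d IHd] le_pd; first by rewrite addn0.
have lt_pd : (p + d < N)%N by rewrite -addnS.
have := full _ lt_pd; have := mono (Ordinal lt_pd).
have := IHd (ltnW lt_pd); rewrite addnS /=; lia.
Qed.

Lemma decreasing_letters_upto b s : decreasing b -> decreasing (b + letters_upto s)%MM.
Proof.
move=> /forallP dec_b; apply/forallP => i; apply/forallP => j; apply/implyP => Ej.
have := forallP (dec_b i) j; rewrite Ej !mnmDE !mnmE /=.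
by move/eqP: Ej => /=; lia.
Qed.

(** At [q = 0] only strict columns count, and among them [canon_unique] leaves a single choice for
    each column. *)
Lemma straight_yam (hs : seq nat) s0 b :
    path leq s0 hs -> (s0 <= B)%N -> all (fun s => (s <= N)%N && (s <= B)%N) hs ->
    (forall i j : 'I_N, j = i.+1 :> nat -> (b j < b i)%N -> (j <= s0)%N) ->
    decreasing b ->
  \sum_(o <- objs [seq (0%N, s) | s <- hs] (canon s0) | yam b o)
    (0 : int) ^+ total_excess o *: alt 'X_[b + wt o] =
  alt 'X_[b + \sum_(s <- hs) letters_upto s].
Proof.
elim: hs s0 b => [|s hs IH] s0 b /=.
  by rewrite big_cons /wt /total_excess !big_nil expr0 scale1r addr0.
move=> /andP[le_s0s path_hs] le_s0B /andP[/andP[le_sN le_sB] all_hs] b_drop dec_b.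
rewrite big_mkcond big_objs_cons /=.
have fits_canon : is_chain 0 s (canon s) && above (canon s0) (canon s).
  apply/andP; split; last first.
    apply/forallP => p; have le_pN : (p <= N)%N by rewrite -ltnS ltn_ord.
    by rewrite !ht_canon //; lia.
  rewrite /is_chain !ht_canon // min0n eqxx (minn_idPr le_sN) eqxx /=.
  by apply/forallP => p; have le_pN := ltnW (ltn_ord p); rewrite !ht_canon //; lia.
rewrite (bigD1 (canon s)) //= [X in _ + X]big1 => [|c /andP[/andP[ch_c abv_c] neq_c]].
  rewrite addr0 colwt_canon // decreasing_letters_upto //= -big_mkcond /=.
  (* [letters_upto s] drops only from index [s - 1] to [s], and [s0 <= s]. *)
  have b_drop' (i j : 'I_N) : j = i.+1 :> nat ->
      ((b + letters_upto s)%MM j < (b + letters_upto s)%MM i)%N -> (j <= s)%N.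
    move=> Ej; rewrite !mnmDE !mnmE => lt_b.
    by have := b_drop i j Ej; lia.
  rewrite big_cons addmA.
  rewrite -(IH s _ path_hs le_sB all_hs b_drop' (decreasing_letters_upto s dec_b)).
  apply: eq_bigr => o _.
  by rewrite wt_cons total_excess_cons (colwt_canon le_sB) (excess_canon le_sB) addmA.
apply: big1 => o _; case: ifP => // /andP[dec_c _].
have exc_c : (0 < excess c)%N.
  rewrite lt0n; apply: contraNneq neq_c => exc_c; apply/eqP.
  exact: (canon_unique le_s0B le_sB b_drop ch_c abv_c exc_c dec_c).
by rewrite total_excess_cons exprD expr0n (gtn_eqF exc_c) mul0r scale0r.
Qed.

End StraightShape.

Local Close Scope ring_scope.

(** * Heights of the columns of a reverse plane partition *)

Lemma lt_count_initial (P : pred nat) n i :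
    (forall i j, i <= j -> P j -> P i) -> i < n ->
  (i < count P (iota 0 n)) = P i.
Proof.
move=> P_down; elim: n => // n IHn lt_in.
have -> : iota 0 n.+1 = iota 0 n ++ [:: n] by rewrite -(addn1 n) iotaD.
rewrite count_cat /= addn0.
have le_n : count P (iota 0 n) <= n.
  by rewrite -[leqRHS](size_iota 0) count_size.
have [Pn | nPn] := boolP (P n).
  have -> : count P (iota 0 n) = n.
    rewrite -[RHS](size_iota 0); apply/eqP; rewrite -all_count; apply/allP => j.
    by rewrite mem_iota => /andP[_ lt_jn]; apply: P_down Pn; apply: ltnW.
  by rewrite addn1 lt_in; apply/esym/(P_down _ n).
rewrite addn0; move: lt_in; rewrite ltnS leq_eqVlt => /predU1P[-> | /IHn //].
by rewrite (negPf nPn) ltnNge le_n.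
Qed.

Lemma ltn_ext m n : (forall i, (i < m) = (i < n)) -> m = n.
Proof.
by move=> E; have := E m; have := E n; rewrite !ltnn; lia.
Qed.

Lemma nth_partition la i j : is_partition la -> i <= j -> nth 0 la j <= nth 0 la i.
Proof.
move=> /andP[sorted_la _] le_ij.
have [lt_j | ge_j] := ltnP j (size la); last by rewrite nth_default.
apply: (sorted_leq_nth (leT := geq)) => //; rewrite ?inE ?(leq_ltn_trans le_ij) //.
  by move=> a b c; rewrite /geq /= => h1 h2; apply: leq_trans h1.
exact: leqnn.
Qed.

Definition conj (la : seq nat) (j : nat) : nat := count (fun x => j < x) la.

Lemma lt_conj la i j : is_partition la -> (i < conj la j) = (j < nth 0 la i).
Proof.
move=> part_la; have -> : conj la j = count (fun i => j < nth 0 la i) (iota 0 (size la)).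
  by rewrite -[in LHS](mkseq_nth 0 la) /conj /mkseq count_map.
have [lt_i | ge_i] := ltnP i (size la).
  rewrite lt_count_initial // => a b le_ab; move/leq_trans; apply.
  exact: nth_partition.
rewrite nth_default // ltn0 ltnNge (leq_trans _ ge_i) //.
by rewrite -[leqRHS](size_iota 0) count_size.
Qed.

Section ColumnHeights.
Variables (nu la : seq nat).
Hypotheses (part_nu : is_partition nu) (part_la : is_partition la).
Hypothesis (sub_la : part_incl la nu).
Implicit Types (r : filling) (i j p : nat).

(** Cells of [la] hold the default 0 and count at every [p]: heights are measured from row 0 and
    start at the column height of [la]. *)
Definition colht r p j : nat :=
  count (fun i => (j < nth 0 nu i) && (r (i, j) <= p)) (iota 0 (size nu)).

Lemma colht_le_size r p j : colht r p j <= size nu.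
Proof. by rewrite -[leqRHS](size_iota 0) count_size. Qed.

Variable r : filling.
Hypothesis (rpp_r : reverse_plane_partition nu la r).

Lemma filling_out c : ~~ in_skew nu la c -> r c = 0.
Proof.
by case: rpp_r => fill_r _ _; rewrite -fill_r lt0n negbK => /eqP.
Qed.

(** Columns increase upwards from the default 0 on [la], so the cells with entry at most [p] fill an
    initial segment of the rows. *)
Lemma lt_colht p i j : (i < colht r p j) = (j < nth 0 nu i) && (r (i, j) <= p).
Proof.
have [lt_i | ge_i] := ltnP i (size nu); last first.
  by rewrite nth_default //= ltnNge (leq_trans (colht_le_size _ _ _)).
rewrite lt_count_initial // => a b le_ab /andP[lt_j le_rp].
rewrite (leq_trans lt_j (nth_partition part_nu le_ab)) /=.
have [a_in | a_out] := boolP (in_skew nu la (a, j)); last by rewrite filling_out.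
apply: leq_trans le_rp; case: rpp_r => _ _; apply=> //.
move: a_in; rewrite /in_skew /= lt_j andbT => /andP[le_la _].
exact: leq_trans (nth_partition part_la le_ab) le_la.
Qed.

Lemma colht0 j : colht r 0 j = conj la j.
Proof.
apply: ltn_ext => i; rewrite lt_colht lt_conj // leqn0.
case: rpp_r => /(_ (i, j)); rewrite lt0n /in_skew /= => E _ _.
have := sub_la i; move: E; case: (r _ == 0) => /= E; lia.
Qed.

Lemma colht_mono p p' j : p <= p' -> colht r p j <= colht r p' j.
Proof.
by move=> le_p; apply: sub_count => i /= /andP[-> le_r]; apply: leq_trans le_p.
Qed.

Lemma colht_above p j j' : j <= j' -> colht r p j' <= colht r p j.
Proof.
move=> le_j; apply: sub_count => i /= /andP[lt_j le_r].
rewrite (leq_ltn_trans le_j lt_j) /=.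
have [j_in | j_out] := boolP (in_skew nu la (i, j)); last by rewrite filling_out.
apply: leq_trans le_r; case: rpp_r => _ + _; apply=> //.
move: j_in; rewrite /in_skew /= lt_j andbT => /andP[le_la _].
exact: leq_trans le_la le_j.
Qed.

Lemma colht_full N j : (forall c, r c <= N) -> colht r N j = conj nu j.
Proof. by move=> le_N; apply: ltn_ext => i; rewrite lt_colht lt_conj // le_N andbT. Qed.

Lemma column_has_letter p j :
  reflect (exists i, r (i, j) = p.+1) (colht r p j < colht r p.+1 j).
Proof.
apply: (iffP idP) => [|[i Er]].
  rewrite lt_colht => /andP[lt_j le_r]; exists (colht r p j).
  apply/eqP; rewrite eqn_leq le_r ltnNge /=; apply/negP => le_rp.
  by have := lt_colht p (colht r p j) j; rewrite ltnn lt_j le_rp.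
have ij_in : in_skew nu la (i, j) by case: rpp_r => <- _ _; rewrite Er.
have lt_j : j < nth 0 nu i by move: ij_in => /andP[].
apply: leq_trans (_ : i < _); last by rewrite lt_colht lt_j Er /=.
by rewrite ltnS leqNgt lt_colht lt_j Er ltnn.
Qed.

Lemma rpp_weightE p :
  rpp_weight r p = count (fun j => colht r p j < colht r p.+1 j)
                     (iota 0 (nth 0 nu 0)).
Proof.
rewrite /rpp_weight -size_filter; apply/perm_size/uniq_perm.
- exact: fset_uniq.
- by rewrite filter_uniq // iota_uniq.
move=> j; rewrite mem_filter mem_iota /= add0n.
apply/imfsetP/andP => [[[i j'] /= /andP[_ /eqP Er] ->] | [/column_has_letter[i Er] _]].
  split; first by apply/column_has_letter; exists i.
  have : in_skew nu la (i, j') by case: rpp_r => <- _ _; rewrite Er.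
  by move=> /andP[_ /leq_trans]; apply; apply: nth_partition.
by exists (i, j) => //; rewrite inE mem_finsupp Er eqxx.
Qed.

End ColumnHeights.

(** * Membership in the list of fillings *)

Section ObjsMembership.
Variables N B : nat.
Implicit Types (c : chain N B) (cs : seq (nat * nat)).

Lemma mem_objs_cons t s cs c c' (o : seq (chain N B)) :
  (c' :: o \in objs ((t, s) :: cs) c) =
  [&& is_chain t s c', above c c' & o \in objs cs c'].
Proof.
apply/allpairsPdep/and3P => [[c1 [o1 [+ o1_in [-> ->]]]] | [ch abv o_in]].
  by rewrite mem_enum => /andP[].
by exists c', o; rewrite mem_enum inE ch abv.
Qed.

Lemma uniq_objs cs c : uniq (objs cs c).
Proof.
elim: cs c => [|[t s] cs IH] c //=.
apply: allpairs_uniq_dep => //; first exact: enum_uniq.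
by move=> [c1 o1] [c2 o2] _ _ /= [-> ->].
Qed.

Lemma size_objs cs c o : o \in objs cs c -> size o = size cs.
Proof.
elim: cs c o => [|[t s] cs IH] c o /=; first by rewrite inE => /eqP->.
by move=> /allpairsPdep[c1 [o1 [_ /IH Eo ->]]] /=; rewrite Eo.
Qed.

Lemma rev_iotaS n : rev (iota 0 n.+1) = n :: rev (iota 0 n).
Proof. by rewrite -(addn1 n) iotaD rev_cat. Qed.

Lemma mem_objs_map (ts : nat -> nat * nat) (G : nat -> chain N B) n c :
  reflect
    [/\ forall j, j < n -> is_chain (ts j).1 (ts j).2 (G j),
        forall j, j.+1 < n -> above (G j.+1) (G j) &
        0 < n -> above c (G n.-1)]
    ([seq G j | j <- rev (iota 0 n)] \in objs [seq ts j | j <- rev (iota 0 n)] c).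
Proof.
elim: n c => [|n IHn] c; first by rewrite inE; constructor.
rewrite rev_iotaS /= (surjective_pairing (ts n)) mem_objs_cons.
apply: (iffP and3P) => [[ch abv /IHn[chs abvs abv_n]] | [chs abvs abv]].
  split=> // j; rewrite ltnS.
    by rewrite leq_eqVlt => /predU1P[-> | /chs].
  rewrite leq_eqVlt => /predU1P[Ej | /abvs //].
  by rewrite Ej; move: abv_n; rewrite -Ej; apply.
split; [exact: chs | exact: abv |]; apply/IHn; split=> [j lt_jn | j lt_jn | n_gt0].
- by apply: chs; apply: ltnW.
- by apply: abvs; apply: ltnW.
- by have := abvs n.-1; rewrite prednK //; apply.
Qed.
End ObjsMembership.

(** * Bounded reverse plane partitions as sequences of chains *)

Section Bijection.
Variables (nu la : seq nat) (N : nat).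
Hypotheses (part_nu : is_partition nu) (part_la : is_partition la).
Hypothesis (sub_la : part_incl la nu).
Local Notation C := (nth 0 nu 0).
Local Notation chain := (chain N (size nu)).

Definition skew_cols : seq (nat * nat) :=
  [seq (conj la j, conj nu j) | j <- rev (iota 0 C)].

Definition col (r : filling) (j : nat) : chain :=
  [ffun p : 'I_N.+1 => inord (colht nu r p j)].

Definition obj (r : filling) : seq chain := [seq col r j | j <- rev (iota 0 C)].

Lemma ht_col r j p : p <= N -> ht (col r j) p = colht nu r p j.
Proof.
by move=> le_pN; rewrite /ht ffunE inordK ?ltnS ?colht_le_size // inordK.
Qed.

Definition bounded_rpp : set filling :=
  [set r | reverse_plane_partition nu la r /\ forall c, r c <= N]%classic.

Definition skew_objs : seq (seq chain) := objs skew_cols (canon N (size nu) 0).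

Lemma obj_in r : bounded_rpp r -> obj r \in skew_objs.
Proof.
move=> [rpp_r le_rN]; apply/(mem_objs_map (fun j => (conj la j, conj nu j))).
split=> [j _ | j _ | _].
- rewrite /is_chain !ht_col //= (colht0 part_nu part_la sub_la rpp_r) eqxx.
  rewrite (colht_full part_nu part_la rpp_r) // eqxx; apply/forallP => p.
  by rewrite !ht_col ?colht_mono // ltnW.
- apply/forallP => p; have le_pN : p <= N by rewrite -ltnS.
  by rewrite !ht_col // (colht_above rpp_r).
- by apply/forallP => p; rewrite ht_canon ?minn0 // -ltnS.
Qed.

(** The heights determine an entry: it is at most [p] exactly when its row lies below the height at
    [p]. *)
Lemma obj_inj : set_inj bounded_rpp obj.
Proof.
move=> r r' /set_mem[rpp_r le_rN] /set_mem[rpp_r' le_r'N] Eobj.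
apply/fsfunP => -[i j].
have [ij_in | ij_out] := boolP (in_skew nu la (i, j)); last first.
  by rewrite (filling_out rpp_r) ?(filling_out rpp_r').
have lt_j : j < nth 0 nu i by case/andP: ij_in.
have lt_jC : j < C by apply: leq_trans lt_j (nth_partition part_nu _).
have Ecol : col r j = col r' j.
  by move/eq_in_map: Eobj; apply; rewrite mem_rev mem_iota.
have E p : p <= N -> (r (i, j) <= p) = (r' (i, j) <= p).
  move=> le_pN; have := lt_colht part_nu part_la rpp_r p i j.
  rewrite lt_j /= -ht_col // Ecol ht_col // => <-.
  by rewrite (lt_colht part_nu part_la rpp_r') lt_j.
have := E _ (le_rN (i, j)); have := E _ (le_r'N (i, j)); lia.
Qed.

Lemma obj_surj : set_surj bounded_rpp [set` skew_objs]%classic obj.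
Proof.
move=> o /= o_in; pose G j := nth (canon N (size nu) 0) (rev o) j.
have Eo : o = [seq G j | j <- rev (iota 0 C)].
  rewrite map_rev -[LHS]revK; congr rev; rewrite /G.
  have := size_objs o_in; rewrite size_map size_rev size_iota -size_rev => <-.
  by rewrite map_nth_iota0 // take_size.
move: o_in; rewrite Eo.
move=> /(mem_objs_map (fun j => (conj la j, conj nu j)))[/= chs abvs _].
have G0 j : j < C -> ht (G j) 0 = conj la j by move=> /chs/and3P[/eqP].
have GN j : j < C -> ht (G j) N = conj nu j by move=> /chs/and3P[_ /eqP].
have GS j : j < C -> forall p, p < N -> ht (G j) p <= ht (G j) p.+1.
  by move=> /chs/and3P[_ _ /forallP mono] p lt_pN; apply: (mono (Ordinal lt_pN)).
have Gmono j : j < C -> forall p p', p <= p' -> p' <= N -> ht (G j) p <= ht (G j) p'.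
  move=> lt_j p p'; elim: p' => [|p' IHp]; first by rewrite leqn0 => /eqP->.
  rewrite leq_eqVlt => /predU1P[-> // | le_p] lt_p'.
  by apply: leq_trans (IHp le_p (ltnW lt_p')) _; apply: GS.
have Gabove p j j' : p <= N -> j <= j' -> j' < C -> ht (G j') p <= ht (G j) p.
  move=> le_pN; elim: j' => [|j' IHj]; first by rewrite leqn0 => /eqP->.
  rewrite leq_eqVlt => /predU1P[-> // | le_j] lt_j'.
  apply: leq_trans (IHj le_j (ltnW lt_j')).
  by move/forallP/(_ (inord p)): (abvs _ lt_j'); rewrite inordK.
(* On a cell of the shape this is the least [p] whose height exceeds [i], the entry prescribed by
   the heights. *)
pose val i j := count (fun p => ht (G j) p <= i) (iota 0 N.+1).
have lt_val i j p : j < C -> p <= N -> (p < val i j) = (ht (G j) p <= i).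
  move=> lt_j le_pN.
  (* Beyond [N], [ht] falls back on index 0; capping the index keeps the predicate monotone. *)
  pose P p' := ht (G j) (minn p' N) <= i.
  have -> : val i j = count P (iota 0 N.+1).
    apply: eq_in_count => p'; rewrite mem_iota add0n ltnS => /andP[_ le_p'].
    by rewrite /P (minn_idPl le_p').
  rewrite lt_count_initial ?ltnS // => [|a b le_ab].
    by rewrite /P (minn_idPl le_pN).
  by apply: leq_trans; apply: Gmono; lia.
pose cells : {fset cell} :=
  seq_fset tt [seq (i, j) | i <- iota 0 (size nu), j <- iota 0 C].
pose r : filling :=
  [fsfun c in cells => if in_skew nu la c then val c.1 c.2 else 0].
have skew_lt i j : in_skew nu la (i, j) -> j < C.
  by move=> /andP[_ /leq_trans]; apply; apply: nth_partition.
have rE i j : r (i, j) = if in_skew nu la (i, j) then val i j else 0.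
  rewrite fsfunE seq_fsetE; case: ifP => // /negP ij_out; case: ifP => // ij_in.
  case: ij_out; apply: allpairs_f; rewrite mem_iota ?(skew_lt _ _ ij_in) //=.
  rewrite add0n ltnNge; apply/negP => ge_i; move: ij_in; rewrite /in_skew /=.
  by rewrite [nth 0 nu i]nth_default // ltn0 andbF.
have r_le p i j : p <= N -> in_skew nu la (i, j) -> (r (i, j) <= p) = (i < ht (G j) p).
  move=> le_pN ij_in; rewrite rE ij_in leqNgt.
  by rewrite (lt_val _ _ _ (skew_lt _ _ ij_in)) // ltnNge.
have r_leN c : r c <= N.
  case: c => i j; have [ij_in | /negPf ij_out] := boolP (in_skew nu la (i, j)).
    by rewrite r_le // GN ?(skew_lt _ _ ij_in) // lt_conj //; case/andP: ij_in.
  by rewrite rE ij_out.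
have rpp_r : reverse_plane_partition nu la r.
  split=> [[i j] | i j j' le_j ij_in ij'_in | i i' j le_i ij_in i'j_in].
  - rewrite rE; case: ifP => // ij_in; rewrite (lt_val _ _ _ (skew_lt _ _ ij_in)) //.
    by rewrite G0 ?(skew_lt _ _ ij_in) // leqNgt lt_conj // -leqNgt; case/andP: ij_in.
  - rewrite r_le ?r_leN //.
    apply: leq_trans (Gabove _ _ _ (r_leN _) le_j (skew_lt _ _ ij'_in)).
    by rewrite -r_le ?r_leN.
  - by rewrite r_le ?r_leN //; apply: leq_ltn_trans le_i _; rewrite -r_le ?r_leN.
exists r; first by split.
apply/eq_in_map => j; rewrite mem_rev mem_iota add0n => /andP[_ lt_j].
apply/ffunP => p; apply: val_inj.
suff : ht (col r j) p = ht (G j) p by rewrite /ht inord_val.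
have le_pN : p <= N by rewrite -ltnS.
rewrite ht_col //; apply: ltn_ext => i; rewrite (lt_colht part_nu part_la rpp_r).
have [ij_in | ij_out] := boolP (in_skew nu la (i, j)).
  by rewrite r_le //; case/andP: ij_in => _ ->.
rewrite rE (negPf ij_out) andbT.
have [lt_ji | ge_ji] := ltnP j (nth 0 nu i).
  apply/esym/(leq_trans _ (Gmono _ lt_j 0 p (leq0n _) le_pN)).
  by rewrite G0 // lt_conj //; move: ij_out; rewrite /in_skew /= lt_ji andbT -ltnNge.
apply/esym/negbTE; rewrite -leqNgt; apply: leq_trans (Gmono _ lt_j p N le_pN (leqnn _)) _.
by rewrite GN // leqNgt lt_conj // -leqNgt.
Qed.

Lemma sum_bounded_rpp (F : filling -> int) (H : seq chain -> int) :
    (forall r, bounded_rpp r -> F r = H (obj r)) ->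
  (\sum_(r \in bounded_rpp) F r = \sum_(o <- skew_objs) H o)%R.
Proof.
move=> EF; rewrite [RHS]fsbig_seq ?uniq_objs // [RHS](reindex_fsbig obj bounded_rpp).
  by apply: eq_fsbigr => r /set_mem/EF.
split; [by move=> r /obj_in | exact: obj_inj | exact: obj_surj].
Qed.
End Bijection.

(** * Coefficients *)

Section Coefficients.
Variables (nu la : seq nat) (N : nat).
Hypotheses (part_nu : is_partition nu) (part_la : is_partition la).
Hypothesis (sub_la : part_incl la nu).
Local Notation C := (nth 0 nu 0).

Lemma wt_obj r (p : 'I_N) : reverse_plane_partition nu la r ->
  wt (obj nu N r) p = rpp_weight r p.
Proof.
move=> rpp_r; rewrite (rpp_weightE part_nu part_la rpp_r).
rewrite /wt mnm_sumE big_map (perm_big (iota 0 C)) ?perm_rev //=.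
rewrite -sum1_count [RHS]big_mkcond; apply: eq_bigr => j _.
by rewrite mnmE !ht_col ?(ltnW (ltn_ord p)) //; case: ltnP.
Qed.

(** Equal entries in one column amount to a gap of at least two between consecutive heights. *)
Lemma total_excess_obj_eq0 r : bounded_rpp nu la N r ->
  (total_excess (obj nu N r) == 0) = `[< cols_strict nu la r >].
Proof.
move=> [rpp_r le_rN]; apply/idP/asboolP.
  rewrite /total_excess big_map sum_nat_seq_eq0 => /allP gap1 i i' j lt_i ij_in i'j_in.
  have lt_jC : j < C.
    by case/andP: ij_in => _ /leq_trans; apply; apply: nth_partition.
  have rij_gt0 : 0 < r (i, j) by case: rpp_r => ->.
  rewrite ltnNge; apply/negP => le_r.
  have lt_p : (r (i, j)).-1 < N by rewrite prednK.
  have := gap1 j; rewrite mem_rev mem_iota add0n lt_jC => /(_ isT) /=.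
  rewrite excess_eq0 => /forallP/(_ (Ordinal lt_p)) /=.
  rewrite prednK // !ht_col ?(ltnW lt_p) // leqNgt; apply/negP/negPn.
  have lt_top : i' < colht nu r (r (i, j)) j.
    by rewrite (lt_colht part_nu part_la rpp_r) le_r andbT; case/andP: i'j_in.
  have ge_bot : colht nu r (r (i, j)).-1 j <= i.
    rewrite leqNgt (lt_colht part_nu part_la rpp_r) negb_and -(ltnNge _.-1) prednK //.
    by rewrite leqnn orbT.
  by apply: leq_ltn_trans lt_top; apply: leq_ltn_trans ge_bot lt_i.
move=> strict_r; rewrite /total_excess big_map sum_nat_seq_eq0.
apply/allP => j _; rewrite excess_eq0 /=; apply/forallP => p.
rewrite !ht_col ?(ltnW (ltn_ord p)) // leqNgt; apply/negP => lt_p.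
set i := colht nu r p j in lt_p.
have row (a : nat) : i <= a -> a < colht nu r p.+1 j ->
    in_skew nu la (a, j) /\ r (a, j) = p.+1.
  move=> le_a; rewrite (lt_colht part_nu part_la rpp_r) => /andP[lt_j le_r].
  have Er : r (a, j) = p.+1.
    apply/eqP; rewrite eqn_leq le_r ltnNge; apply/negP => le_rp.
    have := lt_colht part_nu part_la rpp_r p a j.
    by rewrite lt_j le_rp ltnNge le_a.
  by split=> //; case: rpp_r => <- _ _; rewrite Er.
have [in1 E1] := row i (leqnn _) (ltnW lt_p).
have [in2 E2] := row i.+1 (leqnSn _) lt_p.
by have := strict_r _ _ _ (ltnSn i) in1 in2; rewrite E1 E2 ltnn.
Qed.

Lemma ssyt_weight_strict r : reverse_plane_partition nu la r ->
  cols_strict nu la r -> ssyt_weight r = rpp_weight r.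
Proof.
move=> rpp_r strict_r; apply/funext => p; rewrite /ssyt_weight /rpp_weight.
have in_of c : c \in finsupp r -> r c == p.+1 -> in_skew nu la c.
  by move=> _ /eqP Er; case: rpp_r => <- _ _; rewrite Er.
apply/esym; rewrite !card_in_imfset //=.
move=> [i j] [i' j'] /= /andP[c_in Er] /andP[c'_in Er'] /= Ej.
rewrite -{}Ej in c'_in Er' *.
have ij := in_of _ c_in Er; have i'j := in_of _ c'_in Er'.
move: Er Er' => /eqP Er /eqP Er'.
case: (ltngtP i i') => [lt_i | lt_i | -> //].
  by have := strict_r _ _ _ lt_i ij i'j; rewrite Er Er' ltnn.
by have := strict_r _ _ _ lt_i i'j ij; rewrite Er Er' ltnn.
Qed.

Variable m : exponent.
Hypothesis m_supp : forall i, N <= i -> m i = 0.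

Definition expo : 'X_{1..N} := [multinom m i | i < N].

Lemma monomial_obj r : bounded_rpp nu la N r ->
  monomial (rpp_weight r) m = (('X_[wt (obj nu N r)] : {mpoly int[N]})@_expo)%R.
Proof.
move=> [rpp_r le_rN]; rewrite /monomial mcoeffX.
suff -> : (wt (obj nu N r) == expo) = `[< forall i, m i = rpp_weight r i >].
  by case: asboolP.
apply/eqP/asboolP => [/mnmP Ew i | Ew]; last first.
  by apply/mnmP => p; rewrite wt_obj // mnmE Ew.
have [lt_iN | ge_iN] := ltnP i N.
  by have := Ew (Ordinal lt_iN); rewrite wt_obj // mnmE.
rewrite m_supp // (rpp_weightE part_nu part_la rpp_r); apply/esym/eqP.
rewrite eqn0Ngt -has_count -all_predC; apply/allP => j _ /=.
apply/negP => /(column_has_letter part_nu part_la rpp_r)[i' Er].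
by have := le_rN (i', j); rewrite Er ltnNge ge_iN.
Qed.

(** A letter above [N] gives a positive exponent where [m] vanishes; hence this coefficient sees
    only bounded fillings. *)
Lemma monomial_unbounded r : reverse_plane_partition nu la r ->
  ~ bounded_rpp nu la N r -> monomial (rpp_weight r) m = 0%R.
Proof.
move=> rpp_r unb; rewrite /monomial; case: asboolP => // Em; case: unb; split=> // -[i j].
rewrite leqNgt; apply/negP => lt_N.
have Er : r (i, j) = (r (i, j)).-1.+1 by rewrite prednK // (leq_ltn_trans _ lt_N).
have le_N : N <= (r (i, j)).-1 by rewrite -ltnS -Er.
have := Em (r (i, j)).-1; rewrite m_supp // (rpp_weightE part_nu part_la rpp_r).
move=> /esym/eqP; rewrite eqn0Ngt -has_count => /hasPn/(_ j).
rewrite mem_iota add0n /=.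
have -> : j < C.
  have : in_skew nu la (i, j) by case: rpp_r => <- _ _; rewrite Er.
  by case/andP=> _ /leq_trans; apply; apply: nth_partition.
by move=> /(_ isT)/negP; apply; apply/(column_has_letter part_nu part_la rpp_r); exists i.
Qed.

Lemma dual_grothendieck_coef : dual_grothendieck nu la m =
  ((column_sum 1 (skew_cols nu la) (canon N (size nu) 0))@_expo)%R.
Proof.
rewrite column_sumE raddf_sum /dual_grothendieck /formal_sum /=.
transitivity (\sum_(r \in bounded_rpp nu la N) monomial (rpp_weight r) m)%R.
  apply/esym/fsbig_widen => [r [] // | r [/= rpp_r unb]].
  exact: monomial_unbounded.
apply: sum_bounded_rpp => // r r_in.
by rewrite monomial_obj // expr1n scale1r.
Qed.
End Coefficients.

Lemma is_partition_nil : is_partition [::]. Proof. by []. Qed.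

Lemma part_incl_nil mu : part_incl [::] mu.
Proof. by move=> i; rewrite nth_nil. Qed.

(** The powers of 0 select the tableaux: [0 ^+ 0 = 1] keeps the column-strict fillings, and all
    others get weight 0. *)
Lemma schur_coef mu N (m : exponent) : is_partition mu ->
    (forall i, N <= i -> m i = 0) ->
  schur mu m = ((column_sum 0 (skew_cols mu [::]) (canon N (size mu) 0))@_(expo N m))%R.
Proof.
move=> part_mu m_supp; rewrite column_sumE raddf_sum /schur /formal_sum /=.
pose S := [set r | bounded_rpp mu [::] N r /\ cols_strict mu [::] r]%classic.
(* Extension by zero to all bounded reverse plane partitions, to match those powers. *)
pose F r := if `[< cols_strict mu [::] r >] then monomial (ssyt_weight r) m else 0%R.
transitivity (\sum_(r \in bounded_rpp mu [::] N) F r)%R.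
  transitivity (\sum_(r \in S) F r)%R.
    transitivity (\sum_(r \in S) monomial (ssyt_weight r) m)%R; last first.
      by apply: eq_fsbigr => r /set_mem[_ strict_r]; rewrite /F asboolT.
    apply/esym/fsbig_widen => [r [[[f rw cw] le_N] strict_r] | r [/= [f rw strict_r] nS]].
      by split.
    have rpp_r : reverse_plane_partition mu [::] r.
      split=> // i i' j; rewrite leq_eqVlt => /predU1P[-> // | lt_i] ij i'j.
      exact/ltnW/strict_r.
    rewrite (ssyt_weight_strict rpp_r strict_r).
    apply: (monomial_unbounded part_mu is_partition_nil m_supp rpp_r) => r_in.
    exact: nS.
  apply: fsbig_widen => [r [] // | r [/= r_in nS]].
  by rewrite /F asboolF // => strict_r; apply: nS.
apply: sum_bounded_rpp => //; first exact: part_incl_nil.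
move=> r r_in; have [rpp_r _] := r_in.
have := total_excess_obj_eq0 part_mu is_partition_nil (N := N) r_in.
rewrite /F; case: asboolP => [strict_r /eqP -> | _ /negPf exc].
  rewrite expr0 scale1r (ssyt_weight_strict rpp_r strict_r).
  exact: (monomial_obj part_mu is_partition_nil m_supp r_in).
by rewrite expr0n exc scale0r mcoeff0.
Qed.

(** * Schur polynomials as quotients of alternants *)

Definition mnm_of_seq N (mu : seq nat) : 'X_{1..N} := [multinom nth 0 mu i | i < N].

(** Only the filling whose columns are all [canon] survives; its rows are constant, so its weight is
    [mu]. *)
Lemma schur_alt mu N : is_partition mu -> size mu <= N ->
  (column_sum 0 (skew_cols mu [::]) (canon N (size mu) 0) * alt 1 =
   alt 'X_[mnm_of_seq N mu])%R.
Proof.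
move=> part_mu le_mu; rewrite column_sum_alt => [|k lt_kN]; last first.
  by rewrite !ht_canon ?minn0 // ltnW // ltnW.
have -> : skew_cols mu [::] =
    [seq (0, s) | s <- [seq conj mu j | j <- rev (iota 0 (nth 0 mu 0))]].
  by rewrite -map_comp.
under eq_bigr do rewrite -[wt _]add0m.
rewrite straight_yam //.
- rewrite add0m big_map (perm_big (iota 0 (nth 0 mu 0))) ?perm_rev //=.
  congr (alt 'X_[_]); apply/mnmP => i; rewrite mnm_sumE !mnmE.
  under eq_bigr do rewrite mnmE lt_conj //.
  have -> : \sum_(j <- iota 0 (nth 0 mu 0)) nat_of_bool (j < nth 0 mu i) =
      count (fun j => j < nth 0 mu i) (iota 0 (nth 0 mu 0)).
    by rewrite -sum1_count [RHS]big_mkcond; apply: eq_bigr => j _; case: ltnP.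
  apply: ltn_ext => j; have [lt_j | ge_j] := ltnP j (nth 0 mu 0).
    by rewrite lt_count_initial // => a b; apply: leq_ltn_trans.
  rewrite !ltnNge (leq_trans _ ge_j) ?(leq_trans _ ge_j) //.
    exact: nth_partition.
  by rewrite -[leqRHS](size_iota 0) count_size.
- rewrite path_min_sorted; last by apply/allP.
  rewrite map_rev rev_sorted; apply: homo_sorted (iota_sorted 0 _) => a b le_ab.
  by rewrite /conj; apply: sub_count => x /=; apply: leq_ltn_trans.
- apply/allP => s /mapP[j _ ->]; have := count_size (fun x => j < x) mu.
  by rewrite -/(conj mu j) => le_c; rewrite le_c (leq_trans le_c).
- by move=> i j _; rewrite !mnmE.
- by apply/forallP => i; apply/forallP => j; rewrite !mnmE implybT.
Qed.

(** * Tabloids *)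

(** Compare first entries: if [x j < x' j], then [x j] is kept, yet all entries kept from [x'] are
    at least [x' j]. So they agree, are both kept or both deleted, and the comparison moves on. *)
Lemma row_unique (x x' : nat -> nat) (k k' : pred nat) (js : seq nat) :
    pairwise (fun a b => x a <= x b) js -> pairwise (fun a b => x' a <= x' b) js ->
    (forall j, x j = x' j -> k j = k' j) ->
    (forall j, j \in js -> x j < x' j -> k j) ->
    (forall j, j \in js -> x' j < x j -> k' j) ->
    [seq x j | j <- js & k j] = [seq x' j | j <- js & k' j] ->
  {in js, x =1 x'}.
Proof.
move=> + + k_eq; elim: js => // j js IH mono mono' k_lt k'_lt E.
have k_lt1 b : b \in js -> x b < x' b -> k b.
  by move=> b_in; apply: k_lt; rewrite inE b_in orbT.
have k'_lt1 b : b \in js -> x' b < x b -> k' b.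
  by move=> b_in; apply: k'_lt; rewrite inE b_in orbT.
have Ej : x j = x' j.
  case: (ltngtP (x j) (x' j)) => // lt_j.
    have : x j \in [seq x' j0 | j0 <- j :: js & k' j0].
      by rewrite -E /= k_lt ?mem_head //= mem_head.
    move=> /mapP[b]; rewrite mem_filter => /andP[_ b_in] Eb.
    suff : x' j <= x' b by rewrite -Eb leqNgt lt_j.
    move: b_in; rewrite inE => /predU1P[-> // | b_in].
    by case/andP: mono' => /allP/(_ b b_in).
  have : x' j \in [seq x j0 | j0 <- j :: js & k j0].
    by rewrite E /= k'_lt ?mem_head //= mem_head.
  move=> /mapP[b]; rewrite mem_filter => /andP[_ b_in] Eb.
  suff : x j <= x b by rewrite -Eb leqNgt lt_j.
  move: b_in; rewrite inE => /predU1P[-> // | b_in].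
  by case/andP: mono => /allP/(_ b b_in).
move=> b; rewrite inE => /predU1P[-> // |]; apply: IH => //.
- by case/andP: mono.
- by case/andP: mono'.
by move: E; rewrite /= (k_eq _ Ej); case: (k' j) => //= -[].
Qed.

Definition reading_order (c c' : cell) : bool :=
  (c'.1 < c.1) || ((c.1 == c'.1) && (c.2 < c'.2)).

Definition read_after (i0 j0 : nat) (c : cell) : bool :=
  (c.1 < i0) || ((c.1 == i0) && (j0 <= c.2)).

Lemma read_after_up i0 j0 c c' :
  reading_order c c' -> read_after i0 j0 c -> read_after i0 j0 c'.
Proof. rewrite /reading_order /read_after; lia. Qed.

Lemma reading_order_rows (f : nat -> seq nat) n : (forall i, sorted ltn (f i)) ->
  pairwise reading_order (flatten [seq [seq (i, j) | j <- f i] | i <- rev (iota 0 n)]).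
Proof.
move=> f_sorted; elim: n => // n IHn; rewrite rev_iotaS /= pairwise_cat IHn andbT.
apply/andP; split; last first.
  rewrite pairwise_map; move: (f_sorted n); rewrite (sorted_pairwise ltn_trans).
  by apply: sub_pairwise => a b lt_ab; rewrite /reading_order /= eqxx lt_ab orbT.
apply/allrelP => c c' /mapP[j _ ->] /flattenP[s /mapP[i + ->] /mapP[j' _ ->]].
by rewrite mem_rev mem_iota add0n /reading_order /= => ->.
Qed.

(** Used for the reading word: the letters read from a position onwards form a suffix. The next
    lemma serves the converse. *)
Lemma filter_up_drop (T : Type) (e : rel T) (P : pred T) s : pairwise e s ->
    (forall a b, e a b -> P a -> P b) ->
  filter P s = drop (count (predC P) s) s.
Proof.
move=> + P_up; elim: s => //= a s IHs /andP[e_a pw_s].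
have [Pa | nPa] := boolP (P a); last by rewrite add1n /= IHs.
have all_s : all P s by apply: sub_all e_a => b eab; apply: P_up Pa.
rewrite (all_filterP all_s) add0n (_ : count _ s = 0) ?drop0 //.
by apply/eqP; rewrite eqn0Ngt -has_count has_predC negbK.
Qed.

Lemma drop_nth_filter (T : Type) (e : rel T) (P : pred T) s x0 k : pairwise e s ->
    k < size s -> P (nth x0 s k) ->
    (forall a, e a (nth x0 s k) -> ~~ P a) -> (forall a, e (nth x0 s k) a -> P a) ->
  drop k s = filter P s.
Proof.
elim: s k => // a s IHs [|k] /= /andP[e_a pw_s] lt_k Px before_x after_x.
  by rewrite Px (all_filterP _) //; apply: sub_all e_a.
have e_ax : e a (nth x0 s k) by apply: (all_nthP x0 e_a).
by rewrite (negPf (before_x a e_ax)); apply: IHs.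
Qed.

Lemma yam_map (N B' : nat) (G : nat -> chain N B') n (b : 'X_{1..N}) :
  yam b [seq G j | j <- rev (iota 0 n)] <->
  forall m, m < n -> decreasing (b + \sum_(m <= j < n) colwt (G j))%MM.
Proof.
have swap (u v w : 'X_{1..N}) : (u + (v + w) = u + w + v)%MM.
  by apply/mnmP => p; rewrite !mnmDE; lia.
elim: n b => [|n IHn] b //; rewrite rev_iotaS /=.
split=> [/andP[dec_n /IHn dec_m] m | dec_m].
  rewrite ltnS leq_eqVlt => /predU1P[-> | lt_m]; first by rewrite big_nat1.
  by rewrite big_nat_recr ?(ltnW lt_m) //= swap; apply: dec_m.
apply/andP; split; first by have := dec_m n (ltnSn n); rewrite big_nat1.
apply/IHn => m lt_m; have := dec_m m (ltnW lt_m).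
by rewrite big_nat_recr ?(ltnW lt_m) //= swap.
Qed.

Section Tabloids.
Variables (nu la : seq nat).
Hypotheses (part_nu : is_partition nu) (part_la : is_partition la).
Hypothesis (sub_la : part_incl la nu).
Local Notation C := (nth 0 nu 0).
Local Notation B := (size nu).

Lemma topmostP (r : filling) i j :
  reflect (forall i', i < i' -> i' < B -> r (i', j) != r (i, j)) (topmost nu r i j).
Proof.
apply: (iffP forallP) => [top i' lt_i lt_i'B | top i'].
  by have := top (Ordinal lt_i'B); rewrite /= lt_i.
by apply/implyP => lt_i; apply: (top _ lt_i (ltn_ord i')).
Qed.

Lemma row_lt_size i j : in_skew nu la (i, j) -> i < B.
Proof.
move=> ij_in; rewrite ltnNge; apply/negP => ge_i.
by move: ij_in; rewrite /in_skew /= [nth 0 nu i]nth_default // ltn0 andbF.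
Qed.

Lemma col_lt i j : in_skew nu la (i, j) -> j < C.
Proof. by move=> /andP[_ /leq_trans]; apply; apply: nth_partition. Qed.

(** Rows are recovered from the top down. Once the rows above agree, the smaller of two different
    entries cannot recur higher in its column, so it is kept and [row_unique] applies. *)
Lemma associated_tabloid_inj (r r' : filling) :
    reverse_plane_partition nu la r -> reverse_plane_partition nu la r' ->
  associated_tabloid nu la r = associated_tabloid nu la r' -> r = r'.
Proof.
move=> rpp_r rpp_r' ET.
suff rows d i : B <= i + d -> forall j, r (i, j) = r' (i, j).
  by apply/fsfunP => -[i j]; apply: (rows B); rewrite leq_addl.
elim: d i => [|d IHd] i le_B j.
  have ij_out : ~~ in_skew nu la (i, j).
    by apply/negP => /row_lt_size; rewrite ltnNge -[i]addn0 le_B.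
  by rewrite (filling_out rpp_r) ?(filling_out rpp_r').
have [ij_in | ij_out] := boolP (in_skew nu la (i, j)); last first.
  by rewrite (filling_out rpp_r) ?(filling_out rpp_r').
have above_eq i' j' : i < i' -> r (i', j') = r' (i', j').
  by move=> lt_i; apply: IHd; lia.
pose js := [seq j <- iota 0 (nth 0 nu i) | in_skew nu la (i, j)].
have row_mono s : reverse_plane_partition nu la s ->
    pairwise (fun a b => s (i, a) <= s (i, b)) js.
  move=> [_ rw _]; rewrite /js.
  apply: (@sub_in_pairwise _ [pred b | in_skew nu la (i, b)] leq).
  - by move=> a b a_in b_in le_ab; apply: rw.
  - exact: filter_all.
  - rewrite -sorted_pairwise; last exact: leq_trans.
    by apply: sorted_filter (iota_sorted 0 _); apply: leq_trans.
have lt_top s s' j' : reverse_plane_partition nu la s ->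
    reverse_plane_partition nu la s' ->
    (forall i' j', i < i' -> s (i', j') = s' (i', j')) -> in_skew nu la (i, j') ->
    s (i, j') < s' (i, j') -> topmost nu s i j'.
  move=> [fill_s _ _] [fill_s' _ cw] Es ij'_in lt_s; apply/topmostP => i' lt_i _.
  apply/eqP => E; move: lt_s; rewrite -E Es // ltnNge cw //; first exact: ltnW.
  by rewrite -fill_s' -Es // E fill_s.
have := @row_unique (fun b => r (i, b)) (fun b => r' (i, b))
  (topmost nu r i) (topmost nu r' i) js.
apply.
- exact: row_mono.
- exact: row_mono.
- move=> b Eb; apply/topmostP/topmostP => top i' lt_i lt_B.
    by rewrite -above_eq // -Eb top.
  by rewrite above_eq // Eb top.
- by move=> b; rewrite mem_filter => /andP[b_in _]; apply: lt_top.
- move=> b; rewrite mem_filter => /andP[b_in _]; apply: lt_top => // i' j' lt_i.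
  by rewrite above_eq.
- have lt_iB := row_lt_size ij_in.
  move/(congr1 (fun T => nth [::] T i)): ET; rewrite /associated_tabloid.
  rewrite !(nth_map 0) ?size_iota // nth_iota // add0n => E.
  have Efil (s : filling) : [seq b <- js | topmost nu s i b] =
      [seq b <- iota 0 (nth 0 nu i) | in_skew nu la (i, b) && topmost nu s i b].
    by rewrite /js -filter_predI; apply: eq_filter => b /=; rewrite andbC.
  by rewrite !Efil; exact: E.
- by rewrite mem_filter ij_in mem_iota; case/andP: ij_in.
Qed.

Variable r : filling.
Hypothesis (rpp_r : reverse_plane_partition nu la r).

Lemma topmost_colht p i j :
  [&& in_skew nu la (i, j), topmost nu r i j & r (i, j) == p.+1] =
  (colht nu r p j < colht nu r p.+1 j) && (colht nu r p.+1 j == i.+1).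
Proof.
have lt_c := lt_colht part_nu part_la rpp_r.
apply/and3P/andP => [[ij_in /topmostP top /eqP Er] | [lt_p /eqP Eh]].
  have lt_j : j < nth 0 nu i by case/andP: ij_in.
  have lt_i : i < colht nu r p.+1 j by rewrite lt_c lt_j Er /=.
  have ge_i : colht nu r p j <= i by rewrite leqNgt lt_c lt_j Er ltnn.
  split; first exact: leq_ltn_trans lt_i.
  rewrite eqn_leq lt_i andbT leqNgt lt_c; apply/negP => /andP[lt_j1 le_r].
  have i1j_in : in_skew nu la (i.+1, j).
    rewrite /in_skew /= lt_j1 andbT; case/andP: ij_in => /= le_la _.
    exact: leq_trans (nth_partition part_la (leqnSn i)) le_la.
  have := top i.+1 (leqnn _) (row_lt_size i1j_in); rewrite eqn_leq Er le_r /=.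
  by case: rpp_r => _ _ /(_ i i.+1 j (leqnSn i) ij_in i1j_in); rewrite Er => ->.
have := lt_c p.+1 i j; rewrite Eh leqnn => /esym/andP[lt_j le_r].
have := lt_c p i j; rewrite lt_j /= ltnNge -ltnS -Eh lt_p /= => /esym/negbT.
rewrite -ltnNge => lt_pr; have Er : r (i, j) = p.+1 by lia.
split; [by case: rpp_r => <- _ _; rewrite Er | | by rewrite Er].
apply/topmostP => i' lt_i _; apply/eqP; rewrite Er => Er'.
have i'j_in : in_skew nu la (i', j) by case: rpp_r => <- _ _; rewrite Er'.
have := lt_c p.+1 i' j; rewrite Er' leqnn andbT Eh ltnS leqNgt lt_i.
by case/andP: i'j_in => _ ->.
Qed.

Let kept : seq cell :=
  flatten [seq [seq (i, j) | j <- [seq j <- iota 0 (nth 0 nu i)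
                                     | in_skew nu la (i, j) && topmost nu r i j]]
          | i <- rev (iota 0 B)].

Lemma reading_word_kept : reading_word (associated_tabloid nu la r) = map r kept.
Proof.
rewrite /reading_word /associated_tabloid -map_rev map_flatten -map_comp.
by congr flatten; apply: eq_map => i /=; rewrite -map_comp.
Qed.

Lemma pairwise_kept : pairwise reading_order kept.
Proof.
apply: reading_order_rows => i.
by apply: sorted_filter (iota_ltn_sorted 0 _); apply: ltn_trans.
Qed.

Definition letters_from (p j0 : nat) : nat :=
  count (fun j => (j0 <= j) && (colht nu r p j < colht nu r p.+1 j)) (iota 0 C).

Definition letters_after (p i0 j0 : nat) : nat :=
  count (fun j => (colht nu r p j < colht nu r p.+1 j) &&
                  read_after i0 j0 ((colht nu r p.+1 j).-1, j)) (iota 0 C).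

(** The count passes from rows to columns: each column keeps at most one copy of a letter, in the
    row just under its height at [p.+1]. *)
Lemma count_kept p i0 j0 :
  count (fun c => read_after i0 j0 c && (r c == p.+1)) kept = letters_after p i0 j0.
Proof.
rewrite -sum1_count /kept big_flatten big_map (perm_big (iota 0 B)) ?perm_rev //=.
pose V i j := (colht nu r p j < colht nu r p.+1 j) && (colht nu r p.+1 j == i.+1) &&
  read_after i0 j0 (i, j).
transitivity (\sum_(i <- iota 0 B) \sum_(j <- iota 0 C) V i j).
  apply: eq_bigr => i _; rewrite big_map big_filter_cond sum1_count.
  rewrite (_ : \sum_(j <- _) _ = count (V i) (iota 0 C)); last first.
    by rewrite -sum1_count [RHS]big_mkcond; apply: eq_bigr => j _; case: (V i j).
  have le_C := nth_partition part_nu (leq0n i).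
  rewrite -[in RHS](subnKC le_C) iotaD count_cat add0n.
  rewrite (eq_count (a2 := V i)) => [|j] /=; last first.
    by rewrite /V -topmost_colht /= [_ && (r _ == _)]andbC -!andbA.
  rewrite -[LHS]addn0; congr (_ + _); apply/esym/eqP.
  rewrite eqn0Ngt -has_count; apply/hasPn => j; rewrite mem_iota => /andP[ge_j _].
  rewrite /V -topmost_colht; apply/negP => /andP[/and3P[/andP[_ lt_j] _ _] _].
  by move: lt_j; rewrite /= ltnNge ge_j.
rewrite exchange_big /letters_after -sum1_count [RHS]big_mkcond /=.
apply: eq_bigr => j _; transitivity (count (V^~ j) (iota 0 B)).
  by rewrite -sum1_count [RHS]big_mkcond; apply: eq_bigr => i _; case: (V i j).
rewrite /V; case: (ltnP (colht nu r p j)) => [lt_p | _] /=; last first.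
  by apply/eqP; rewrite eqn0Ngt -has_count; apply/hasPn.
case: ifP => [after_j | nafter_j].
  rewrite (eq_count (a2 := pred1 (colht nu r p.+1 j).-1)) => [|i] /=; last first.
    apply/andP/eqP => [[/eqP -> _] // | ->]; rewrite prednK ?(leq_ltn_trans _ lt_p) //.
  rewrite count_uniq_mem ?iota_uniq // mem_iota add0n /=.
  by rewrite prednK ?(leq_ltn_trans _ lt_p) // colht_le_size.
apply/eqP; rewrite eqn0Ngt -has_count; apply/hasPn => i _.
by apply/negP => /andP[/eqP Eh]; move: nafter_j; rewrite Eh /= => ->.
Qed.

(** Each suffix of the reading word consists of the letters read from some position [(i0, j0)]
    onwards, and each position gives a suffix. *)
Lemma yamanouchiP :
  yamanouchi (associated_tabloid nu la r) <->
  forall p i0 j0, letters_after p.+1 i0 j0 <= letters_after p i0 j0.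
Proof.
rewrite /yamanouchi reading_word_kept.
have count_r v (P : pred cell) s :
    count_mem v (map r (filter P s)) = count (fun c => P c && (r c == v)) s.
  by rewrite count_map count_filter; apply: eq_count => c /=; rewrite andbC.
split=> [yam p i0 j0 | lets k [//|p] _].
  have := yam (count (predC (read_after i0 j0)) kept) p.+1 isT.
  rewrite -map_drop -(filter_up_drop pairwise_kept (@read_after_up i0 j0)).
  by rewrite !count_r -!count_kept.
have [lt_k | ge_k] := ltnP k (size kept); last first.
  by rewrite !drop_oversize // size_map.
pose x := nth (0, 0) kept k.
have Edrop : drop k kept = filter (read_after x.1 x.2) kept.
  apply: (drop_nth_filter (x0 := (0, 0)) pairwise_kept lt_k); rewrite -/x.
  - by rewrite /read_after; lia.
  - by move=> a; rewrite /read_after /reading_order; lia.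
  - by move=> a; rewrite /read_after /reading_order; lia.
by rewrite -map_drop Edrop !count_r !count_kept.
Qed.

Lemma letters_from_iota p j0 : letters_from p j0 =
  count (fun j => colht nu r p j < colht nu r p.+1 j) (iota j0 (C - j0)).
Proof.
rewrite /letters_from; have [le_C | ge_C] := leqP j0 C; last first.
  rewrite (eqP (ltnW ge_C : _ - _ == 0)) /=; apply/eqP.
  rewrite eqn0Ngt -has_count; apply/hasPn => j.
  rewrite mem_iota add0n => /andP[_ lt_j] /=.
  by rewrite leqNgt (ltn_trans lt_j).
rewrite -{1}(subnKC le_C) iotaD add0n count_cat (_ : count _ (iota 0 _) = 0).
  by rewrite add0n; apply: eq_in_count => j; rewrite mem_iota => /andP[->].
apply/eqP; rewrite eqn0Ngt -has_count; apply/hasPn => j.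
by rewrite mem_iota add0n /= => lt_j; rewrite leqNgt lt_j.
Qed.

Lemma letters_fromS p j0 : j0 < C ->
  letters_from p j0 = (colht nu r p j0 < colht nu r p.+1 j0) + letters_from p j0.+1.
Proof. by move=> lt_j; rewrite !letters_from_iota -(subnSK lt_j). Qed.

(* A letter p+1 whose topmost occurrence has height h is read from (i0, j0)
   onwards iff h <= i0, or h = i0 + 1 and its column is at least j0. *)
Let reached i0 j0 h j := (h <= i0) || ((h == i0.+1) && (j0 <= j)).

Let letters_afterE p i0 j0 : letters_after p i0 j0 =
  count (fun j => (colht nu r p j < colht nu r p.+1 j) &&
                  reached i0 j0 (colht nu r p.+1 j) j) (iota 0 C).
Proof.
apply: eq_count => j /=; case: ltnP => //= lt_p.
by rewrite /read_after /reached /=; lia.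
Qed.

Lemma letters_after_from :
  (forall p i0 j0, letters_after p.+1 i0 j0 <= letters_after p i0 j0) <->
  (forall p j0, letters_from p.+1 j0 <= letters_from p j0).
Proof.
pose h p j := colht nu r p j.
have h_mono p j : h p j <= h p.+1 j by apply: colht_mono.
have h_down p j j' : j <= j' -> h p j' <= h p j by apply: (colht_above rpp_r).
split=> [after p j0 | from p i0 j0]; last first.
  rewrite !letters_afterE.
  (* From columns to rows: heights decrease to the right, so the columns whose height at [p.+2] is
     reached form a final segment, starting at [J]. A [p.+1] in such a column is no higher, hence
     reached too. *)
  pose Q j := reached i0 j0 (h p.+2 j) j.
  pose J := count (predC Q) (iota 0 C).
  have QJ j : j < C -> Q j = (J <= j).
    move=> lt_j; apply: negb_inj; rewrite -ltnNge lt_count_initial // => a b le_ab.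
    apply: contra; rewrite /Q /reached; have := h_down p.+2 a b le_ab; lia.
  apply: (@leq_trans (letters_from p.+1 J)).
    apply: eq_leq; apply: eq_in_count => j; rewrite mem_iota add0n => /andP[_ lt_j].
    by rewrite -/(h p.+2 j) -/(Q j) QJ // andbC.
  apply: leq_trans (from p J) _; rewrite /letters_from.
  rewrite (eq_in_count (a2 := fun j => Q j && (h p j < h p.+1 j))); last first.
    by move=> j; rewrite mem_iota add0n => /andP[_ lt_j]; rewrite QJ.
  apply: sub_count => j /= /andP[Qj ->] /=; move: Qj; rewrite /Q /reached.
  by have := h_mono p.+1 j; rewrite /h; lia.
(* From rows to columns: the aim is a position from which every topmost [p.+2] in the columns from
   [j0] on is read, but no topmost [p.+1] of an earlier column. *)
elim: j0 => [|j0 IHj].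
  pose i0 := (h p.+2 0).
  have le_from : letters_from p.+1 0 <= letters_after p.+1 i0 0.
    rewrite letters_afterE; apply: sub_count => j /= ->.
    by rewrite /reached (h_down p.+2 0 j).
  have ge_from : letters_after p i0 0 <= letters_from p 0.
    by rewrite letters_afterE; apply: sub_count => j /= /andP[].
  exact: leq_trans le_from (leq_trans (after _ _ _) ge_from).
have [ge_j0 | lt_j0] := leqP C j0.+1.
  rewrite (_ : letters_from p.+1 j0.+1 = 0) //; apply/eqP.
  rewrite eqn0Ngt -has_count; apply/hasPn => j.
  rewrite mem_iota add0n => /andP[_ lt_j] /=.
  by rewrite leqNgt (leq_trans lt_j).
(* In the case [lt_s], column [j0] contains [p.+2], so removing it from both counts preserves the
   inequality of the induction hypothesis. *)
have [le_s | lt_s] := leqP (h p.+2 j0.+1) (h p.+1 j0); last first.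
  move: IHj; rewrite !(letters_fromS _ (ltnW lt_j0)) -/(h p.+1 j0) -/(h p.+2 j0).
  rewrite (leq_trans lt_s (h_down _ _ _ (leqnSn j0))); lia.
(* Height 0 leaves no [p.+2] from [j0.+1] on. Otherwise [(i0, j0.+1)] works: up to column [j0], a
   topmost [p.+1] lies in row [i0] or higher, so it is read earlier. *)
case Es : (h p.+2 j0.+1) => [|i0].
  rewrite (_ : letters_from p.+1 j0.+1 = 0) //; apply/eqP.
  rewrite eqn0Ngt -has_count; apply/hasPn => j _; apply/negP => /andP[le_j].
  rewrite -/(h p.+1 j) -/(h p.+2 j) => lt_h.
  by have := h_down p.+2 _ _ le_j; rewrite Es; lia.
have le_from : letters_from p.+1 j0.+1 <= letters_after p.+1 i0 j0.+1.
  rewrite letters_afterE; apply: sub_count => j /= /andP[le_j ->] /=.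
  by rewrite /reached; have := h_down p.+2 _ _ le_j; rewrite Es /h; lia.
have ge_from : letters_after p i0 j0.+1 <= letters_from p j0.+1.
  rewrite letters_afterE; apply: sub_count => j /= /andP[-> +]; rewrite andbT /reached.
  case: (ltnP j0 j) => // le_j; have := h_down p.+1 _ _ le_j.
  by rewrite -/(h p.+1 j); lia.
exact: leq_trans le_from (leq_trans (after _ _ _) ge_from).
Qed.

Lemma yam_obj N : bounded_rpp nu la N r ->
  yam 0%MM (obj nu N r) <-> forall p j0, letters_from p.+1 j0 <= letters_from p j0.
Proof.
move=> [_ le_rN].
have Ew j0 (p : 'I_N) :
    (\sum_(j0 <= j < C) colwt (col nu N r j))%MM p = letters_from p j0.
  rewrite mnm_sumE letters_from_iota /index_iota -sum1_count [RHS]big_mkcond.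
  apply: eq_bigr => j _; rewrite mnmE !ht_col ?(ltnW (ltn_ord p)) //.
rewrite yam_map; split=> [dec p j0 | le_from m _].
  have [lt_p | ge_p] := ltnP p.+1 N; last first.
    rewrite (_ : letters_from p.+1 j0 = 0) //; apply/eqP.
    rewrite eqn0Ngt -has_count; apply/hasPn => j _; apply/negP => /andP[_].
    move=> /(column_has_letter part_nu part_la rpp_r)[i Er].
    by have := le_rN (i, j); rewrite Er ltnNge ge_p.
  have [lt_j0 | ge_j0] := ltnP j0 C; last first.
    by rewrite letters_from_iota (eqP (ge_j0 : _ - _ == 0)).
  have := dec _ lt_j0; rewrite add0m => /forallP/(_ (Ordinal (ltnW lt_p))).
  by move=> /forallP/(_ (Ordinal lt_p)); rewrite eqxx /= !Ew.
rewrite add0m; apply/forallP => i; apply/forallP => j; apply/implyP => /eqP Ej.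
by rewrite !Ew; have := le_from i m; rewrite -Ej.
Qed.

Lemma yamanouchi_obj N : bounded_rpp nu la N r ->
  yamanouchi (associated_tabloid nu la r) <-> yam 0%MM (obj nu N r).
Proof.
by move=> r_in; rewrite yamanouchiP letters_after_from yam_obj.
Qed.

Lemma count_associated_tabloid p :
  count_mem p.+1 (flatten (associated_tabloid nu la r)) = rpp_weight r p.
Proof.
have -> : count_mem p.+1 (flatten (associated_tabloid nu la r)) =
    count_mem p.+1 (reading_word (associated_tabloid nu la r)).
  by apply/seq.permP/perm_flatten; rewrite perm_sym perm_rev.
rewrite reading_word_kept count_map (rpp_weightE part_nu part_la rpp_r).
(* All kept cells lie below row [B], so reading from [(B, 0)] covers the whole word. *)
transitivity (letters_after p B 0); last first.
  apply: eq_in_count => j _ /=; case: ltnP => //= lt_p.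
  rewrite /read_after /=; have := colht_le_size nu r p.+1 j; lia.
rewrite -count_kept; apply: eq_in_count => -[i j].
move=> /flattenP[s /mapP[i' + ->] /mapP[j' _ [-> ->]]].
by rewrite mem_rev mem_iota add0n /= /read_after /= => ->.
Qed.

Lemma tabloid_associated : tabloid (associated_tabloid nu la r).
Proof.
apply/allP => row /mapP[i _ ->]; apply/andP; split; last first.
  apply/negP => /mapP[j]; rewrite mem_filter => /andP[/andP[ij_in _] _] /esym/eqP.
  by apply/negP; rewrite -lt0n; case: rpp_r => ->.
rewrite (sorted_pairwise leq_trans) pairwise_map.
apply: (@sub_in_pairwise _ [pred b | in_skew nu la (i, b)] leq).
- by move=> a b a_in b_in le_ab; case: rpp_r => _ + _; apply.
- by apply/allP => b; rewrite mem_filter => /andP[/andP[]].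
rewrite -(sorted_pairwise leq_trans).
by apply: sorted_filter (iota_sorted 0 _); apply: leq_trans.
Qed.

End Tabloids.

(** * Weights of Yamanouchi tabloids as partitions *)

Lemma mem_bigmax (s : seq nat) : 0 < \max_(b <- s) b -> \max_(b <- s) b \in s.
Proof.
elim: s => [|a s IHs]; first by rewrite big_nil.
rewrite big_cons inE; have [le_a | lt_a] := leqP (\max_(b <- s) b) a.
  by rewrite eqxx.
by move=> /IHs ->; rewrite orbT.
Qed.

Lemma nth_tabloid_weight T i :
  nth 0 (tabloid_weight T) i = count_mem i.+1 (flatten T).
Proof.
rewrite /tabloid_weight; have [lt_i | ge_i] := ltnP i (\max_(b <- flatten T) b).
  by rewrite nth_mkseq.
rewrite nth_default ?size_mkseq //; apply/esym/count_memPn/negP => i_in.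
by move: ge_i; apply/negP; rewrite -ltnNge; apply: leq_bigmax_seq.
Qed.

(** The whole reading word is one of its suffixes, which gives the order; the largest letter occurs,
    so no part is 0. *)
Lemma is_partition_tabloid_weight T : yamanouchi T -> is_partition (tabloid_weight T).
Proof.
move=> yam_T; pose w i := count_mem i.+1 (flatten T).
have w_down i : w i.+1 <= w i.
  have := yam_T 0 i.+1 isT; rewrite !drop0 /reading_word.
  have E v : count_mem v (flatten (rev T)) = count_mem v (flatten T).
    by apply/seq.permP/perm_flatten; rewrite perm_rev.
  by rewrite !E.
have w_anti i j : i <= j -> w j <= w i.
  move=> /subnKC <-; elim: (j - i) => [|d IHd]; first by rewrite addn0.
  by rewrite addnS; apply: leq_trans (w_down _) IHd.
apply/andP; split.
  apply: (homo_sorted (e := leq)) (iota_sorted 0 _) => a b; exact: w_anti.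
apply/negP => /mapP[i]; rewrite mem_iota add0n => /andP[_ lt_i] /esym/eqP.
apply/negP; rewrite -lt0n; apply: (@leq_trans (w (\max_(b <- flatten T) b).-1)).
  rewrite /w prednK ?(leq_ltn_trans _ lt_i) // -has_count has_pred1.
  by rewrite mem_bigmax // (leq_ltn_trans _ lt_i).
by apply: w_anti; rewrite -ltnS prednK ?(leq_ltn_trans _ lt_i).
Qed.

(** Inverse to [mnm_of_seq] on partitions with at most [N] parts, where only trailing zeros are
    removed. *)
Definition seq_of_mnm N (w : 'X_{1..N}) : seq nat :=
  [seq x <- [seq w i | i <- enum 'I_N] | 0 < x].

Lemma mnm_of_seqK N (mu : seq nat) : 0 \notin mu -> size mu <= N ->
  seq_of_mnm (mnm_of_seq N mu) = mu.
Proof.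
move=> mu_pos le_mu; rewrite /seq_of_mnm.
have -> : [seq mnm_of_seq N mu i | i <- enum 'I_N] = [seq nth 0 mu i | i <- iota 0 N].
  by rewrite -val_enum_ord -map_comp; apply: eq_map => i /=; rewrite mnmE.
rewrite -(subnKC le_mu) iotaD map_cat filter_cat -/(mkseq _ _) mkseq_nth add0n.
have -> : [seq x <- mu | 0 < x] = mu.
  apply/all_filterP/allP => x x_in.
  by rewrite lt0n; apply: contraNneq mu_pos => <-.
rewrite (eq_in_filter (a2 := pred0)) ?filter_pred0 ?cats0 // => x /mapP[i + ->].
by rewrite mem_iota => /andP[ge_i _]; rewrite nth_default.
Qed.

(** The first column increases strictly, so its top entry exceeds [N], and [m] vanishes at the
    corresponding variable. *)
Lemma schur_eq0 mu N (m : exponent) : N < size mu -> is_partition mu ->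
  (forall i, N <= i -> m i = 0) -> schur mu m = 0%R.
Proof.
move=> lt_N part_mu m_supp; apply: fsbig1 => r [fill_r _ strict_r].
rewrite /monomial; case: asboolP => // Em.
have first_col i : i < size mu -> in_skew mu [::] (i, 0).
  move=> lt_i; rewrite /in_skew /= nth_nil /= lt0n.
  by case/andP: part_mu => _; apply: contraNneq => <-; apply: mem_nth.
have ge_row i : i < size mu -> i < r (i, 0).
  elim: i => [|i IHi] lt_i; first by rewrite fill_r first_col.
  apply: leq_ltn_trans (IHi (ltnW lt_i)) _.
  by apply: strict_r => //; apply: first_col => //; apply: ltnW.
have lt_top : (size mu).-1 < size mu by rewrite prednK // (leq_ltn_trans _ lt_N).
pose c := ((size mu).-1, 0); have lt_c := ge_row _ lt_top.
have rc_gt0 : 0 < r c by apply: leq_ltn_trans lt_c.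
have le_N : N <= (r c).-1 by rewrite -/c in lt_c; lia.
have := Em (r c).-1; rewrite m_supp // => /esym/eqP; rewrite /ssyt_weight cardfs_eq0.
move=> /eqP/fsetP/(_ c); rewrite in_fset0 => /negP; case.
by apply/imfsetP; exists c => //; rewrite !inE mem_finsupp -lt0n rc_gt0 prednK //= eqxx.
Qed.

(** * Comparison of coefficients *)

Section Proposition.
Variables (nu la : seq nat).
Hypotheses (part_nu : is_partition nu) (part_la : is_partition la).
Hypothesis (sub_la : part_incl la nu).
Variables (m : exponent) (N : nat).
Hypothesis m_supp : forall i, N <= i -> m i = 0.

Lemma yamanouchi_weight r : reverse_plane_partition nu la r ->
    yamanouchi (associated_tabloid nu la r) ->
  is_partition (tabloid_weight (associated_tabloid nu la r)) /\
  (bounded_rpp nu la N r <-> size (tabloid_weight (associated_tabloid nu la r)) <= N).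
Proof.
move=> rpp_r yam_r; set mu := tabloid_weight _.
have part_mu : is_partition mu by apply: is_partition_tabloid_weight.
have mu_nth i : nth 0 mu i = rpp_weight r i.
  by rewrite nth_tabloid_weight (count_associated_tabloid part_nu part_la rpp_r).
have weight_gt0 p : reflect (exists i, exists2 j, j < nth 0 nu 0 & r (i, j) = p.+1)
    (0 < rpp_weight r p).
  rewrite (rpp_weightE part_nu part_la rpp_r) -has_count; apply: (iffP hasP).
    move=> [j + /(column_has_letter part_nu part_la rpp_r)[i Er]].
    by rewrite mem_iota add0n => /andP[_ lt_j]; exists i, j.
  move=> [i [j lt_j Er]]; exists j; first by rewrite mem_iota add0n.
  by apply/(column_has_letter part_nu part_la rpp_r); exists i.
split=> //; split=> [[_ le_rN] | le_mu].
  rewrite leqNgt; apply/negP => lt_N.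
  have : 0 < nth 0 mu N.
    rewrite lt0n; case/andP: part_mu => _; apply: contraNneq => <-; exact: mem_nth.
  rewrite mu_nth => /weight_gt0[i [j _ Er]].
  by have := le_rN (i, j); rewrite Er ltnn.
split=> // -[i j]; rewrite leqNgt; apply/negP => lt_r.
have r_gt0 : 0 < r (i, j) by apply: leq_ltn_trans lt_r.
have : 0 < rpp_weight r (r (i, j)).-1.
  apply/weight_gt0; exists i, j; last by rewrite prednK.
  by apply: (col_lt part_nu (_ : in_skew nu la (i, j))); case: rpp_r => <-.
by rewrite -mu_nth nth_default //; lia.
Qed.

Lemma mnm_tabloid_weight r : bounded_rpp nu la N r ->
  mnm_of_seq N (tabloid_weight (associated_tabloid nu la r)) = wt (obj nu N r).
Proof.
move=> [rpp_r _]; apply/mnmP => p.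
by rewrite mnmE nth_tabloid_weight (count_associated_tabloid part_nu part_la rpp_r)
  (wt_obj part_nu part_la).
Qed.

(** Each tabloid is replaced by its unique filling. Fillings with a letter above [N] have more than
    [N] parts in their weight and contribute 0 by [schur_eq0]; the others are sequences of
    chains. *)
Lemma sum_yamanouchi_tabloids :
  formal_sum
    [set T | [/\ tabloid T, yamanouchi T & inflated_shape nu la T]]%classic
    (fun T => schur (tabloid_weight T)) m =
  (\sum_(o <- skew_objs nu la N | yam 0%MM o) schur (seq_of_mnm (wt o)) m)%R.
Proof.
pose Y := [set r | reverse_plane_partition nu la r /\
                   yamanouchi (associated_tabloid nu la r)]%classic.
rewrite /formal_sum (reindex_fsbig (associated_tabloid nu la) Y); last first.
  split.
  - move=> r [rpp_r yam_r]; split=> //; first exact: tabloid_associated.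
    by exists r.
  - move=> r r' /set_mem[rpp_r _] /set_mem[rpp_r' _].
    exact: associated_tabloid_inj.
  - by move=> T [_ yam_T [r rpp_r ET]]; exists r => //; split; rewrite // -ET.
pose S := [set r | bounded_rpp nu la N r /\
                   yamanouchi (associated_tabloid nu la r)]%classic.
pose F r := if `[< yamanouchi (associated_tabloid nu la r) >]
  then schur (tabloid_weight (associated_tabloid nu la r)) m else 0%R.
transitivity (\sum_(r \in S) F r)%R.
  transitivity (\sum_(r \in S) schur (tabloid_weight (associated_tabloid nu la r)) m)%R.
    apply/esym/fsbig_widen => [r [[rpp_r _] yam_r] | r [[rpp_r yam_r] nS]] //.
    have [part_mu bounded_mu] := yamanouchi_weight rpp_r yam_r.
    apply: (schur_eq0 (N := N)) => //; rewrite ltnNge; apply/negP => /bounded_mu r_in.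
    exact: nS.
  by apply: eq_fsbigr => r /set_mem[_ yam_r]; rewrite /F asboolT.
transitivity (\sum_(r \in bounded_rpp nu la N) F r)%R.
  apply: fsbig_widen => [r [] // | r [/= r_in nS]].
  by rewrite /F asboolF // => yam_r; apply: nS.
rewrite [RHS]big_mkcond; apply: sum_bounded_rpp => // r r_in; have [rpp_r _] := r_in.
rewrite /F; case: asboolP => yam_r.
  have -> : yam 0%MM (obj nu N r) by apply/(yamanouchi_obj part_nu part_la rpp_r r_in).
  have [part_mu bounded_mu] := yamanouchi_weight rpp_r yam_r.
  rewrite -mnm_tabloid_weight // mnm_of_seqK //; last exact/bounded_mu.
  by case/andP: part_mu.
case: ifP => // /(yamanouchi_obj part_nu part_la rpp_r r_in) //.
Qed.

Lemma partition_of_yam o : o \in skew_objs nu la N -> yam 0%MM o ->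
  [/\ is_partition (seq_of_mnm (wt o)), size (seq_of_mnm (wt o)) <= N &
      mnm_of_seq N (seq_of_mnm (wt o)) = wt o].
Proof.
move=> o_in; have [r r_in <-] := obj_surj part_nu part_la o_in.
have [rpp_r _] := r_in.
move=> /(yamanouchi_obj part_nu part_la rpp_r r_in) yam_r.
have [part_mu bounded_mu] := yamanouchi_weight rpp_r yam_r.
have le_mu := proj1 bounded_mu r_in.
rewrite -mnm_tabloid_weight // mnm_of_seqK //; by case/andP: part_mu.
Qed.

(** Both sides times [alt 1] are the same sum of alternants, and the nonzero factor [alt 1]
    cancels. *)
Lemma column_sum_schur :
  (column_sum 1 (skew_cols nu la) (canon N (size nu) 0) =
   \sum_(o <- skew_objs nu la N | yam 0%MM o)
     column_sum 0 (skew_cols (seq_of_mnm (wt o)) [::])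
       (canon N (size (seq_of_mnm (wt o))) 0))%R.
Proof.
apply: (mulIf (alt1_neq0 N)); rewrite column_sum_alt => [|k lt_kN]; last first.
  by rewrite !ht_canon ?minn0 // ltnW // ltnW.
rewrite mulr_suml big_seq_cond [RHS]big_seq_cond.
apply: eq_bigr => o /andP[o_in yam_o]; rewrite expr1n scale1r.
have [part_mu le_mu mnm_mu] := partition_of_yam o_in yam_o.
by rewrite schur_alt ?mnm_mu.
Qed.

Lemma dual_grothendieck_schur_coef : dual_grothendieck nu la m =
  formal_sum
    [set T | [/\ tabloid T, yamanouchi T & inflated_shape nu la T]]%classic
    (fun T => schur (tabloid_weight T)) m.
Proof.
rewrite sum_yamanouchi_tabloids (dual_grothendieck_coef part_nu part_la sub_la m_supp).
rewrite column_sum_schur raddf_sum /= big_seq_cond [RHS]big_seq_cond.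
apply: eq_bigr => o /andP[o_in yam_o].
have [part_mu _ _] := partition_of_yam o_in yam_o.
by rewrite (schur_coef part_mu m_supp).
Qed.

End Proposition.

Theorem proposition46 (nu la : seq nat) (hnu : is_partition nu)
    (hla : is_partition la) (hsub : part_incl la nu) :
  dual_grothendieck nu la =
  formal_sum
    [set T | [/\ tabloid T, yamanouchi T & inflated_shape nu la T]]%classic
    (fun T => schur (tabloid_weight T)).
Proof.
apply/funext => m.
(* All variables of [m] have index below [N], so finitely many variables decide this coefficient. *)
pose N := (\max_(i <- finsupp m) i).+1.
apply: (@dual_grothendieck_schur_coef nu la hnu hla hsub m N) => i lt_i.
apply: fsfun_dflt; apply: contraTN lt_i => i_in.
by rewrite -leqNgt; apply: leq_bigmax_seq.
Qed.
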